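(* Let $\nu$ be an admissible profile with $\alpha_{\min}\in\mathbb{R}$, and let $$p_0 := \min\Big(1,\ \inf_{\alpha_{\min}\le\alpha<\alpha_{\max}}\underline{\partial}^+\nu(\alpha)\Big).$$ If $p_0>0$, then the topology $\tau$ of $S^\nu$ is induced by the family of norms $x\mapsto\|x\|_{b^{\alpha_{\min}-\varepsilon}_{\infty,\infty}}$, $\varepsilon>0$, together with the $p_0$-norms $$\|x\|_{\alpha,\varepsilon}:=\inf\Big\{\|x'\|_{b^{s}_{p_0,\infty}}+\|x''\|_{b^{\alpha}_{\infty,\infty}}\ :\ x'+x''=x\Big\},$$ where $\alpha\in[\alpha_{\min},\alpha_{\max})$, $\varepsilon>0$ and $s:=\alpha+\frac{1-\nu(\alpha)}{p_0}-\varepsilon$. Moreover, this family can be made countable by restricting to $\alpha\in\{\alpha_n\}$ and $\varepsilon\in\{\varepsilon_m\}$, where $(\alpha_n)$ is any sequence dense in $[\alpha_{\min},\alpha_{\max})$ and $(\varepsilon_m)$ any sequence of positive reals tending to $0$; that is, the resulting countable family induces the same topology.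
   Context: Let $\mathbb{N}_0=\{0,1,2,\dots\}$, $\Lambda=\bigcup_{j\in\mathbb{N}_0}\{j\}\times\{0,\dots,2^j-1\}$ and $\Omega=\mathbb{C}^\Lambda$. An admissible profile is a non-decreasing right-continuous function $\nu:\mathbb{R}\to\{-\infty\}\cup[0,1]$ that is not identically $-\infty$. Put $\alpha_{\min}=\inf\{\alpha:\nu(\alpha)\ge0\}$ and $\alpha_{\max}=\inf\{\alpha:\nu(\alpha)=1\}$, with $\inf\emptyset=+\infty$. The asymptotic profile of $x\in\Omega$ is $\nu_x(\alpha)=\lim_{\varepsilon\to0^+}\limsup_{j\to\infty}\frac{\log \#\{k:|x_{j,k}|\ge 2^{-(\alpha+\varepsilon)j}\}}{\log(2^j)}$ (with $\log 0=-\infty$), and $S^\nu=\{x\in\Omega:\nu_x(\alpha)\le\nu(\alpha)\ \forall\alpha\in\mathbb{R}\}$, which is a vector space. For $\alpha\in\mathbb{R}$ and $\beta\in\{-\infty\}\cup[0,+\infty)$ let $d_{\alpha,\beta}(x,y)=d_{\alpha,\beta}(x-y)$ with $d_{\alpha,\beta}(x)=\inf\{C\ge0:\ \forall j\in\mathbb{N}_0,\ \#\{k:|x_{j,k}|\ge C2^{-\alpha j}\}\le C2^{\beta j}\}$ (with $2^{\beta j}:=0$ if $\beta=-\infty$), and let $E(\alpha,\beta)=\{x\in\Omega:d_{\alpha,\beta}(x)<\infty\}$ with the metric $d_{\alpha,\beta}$. For any sequence $(a_n)$ dense in $\mathbb{R}$ and any sequence $e_m\searrow0$ of positive reals, $S^\nu=\bigcap_{n,m}E(a_n,\nu(a_n)+e_m)$,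 and the topology $\tau$ of $S^\nu$ is the coarsest topology making all inclusions $S^\nu\subset E(a_n,\nu(a_n)+e_m)$ continuous. It is known that $\tau$ does not depend on the choice of these sequences and makes $S^\nu$ a complete metrizable topological vector space. The right-inf derivative, where $\nu(\alpha)>-\infty$, is $\underline{\partial}^+\nu(\alpha)=\liminf_{h\to0^+}\frac{\nu(\alpha+h)-\nu(\alpha)}{h}$. Besov (quasi-)norms of $x\in\Omega$ (possibly $+\infty$): for $\sigma\in\mathbb{R}$ and $0<p<\infty$, $\|x\|_{b^\sigma_{p,\infty}}=\sup_{j\in\mathbb{N}_0}2^{(\sigma-\frac1p)j}\big(\sum_{k=0}^{2^j-1}|x_{j,k}|^p\big)^{1/p}$, and $\|x\|_{b^\sigma_{\infty,\infty}}=\sup_{j\in\mathbb{N}_0}\sup_{0\le k<2^j}2^{\sigma j}|x_{j,k}|$; $b^\sigma_{p,\infty}$ is the space of $x\in\Omega$ for which this is finite. In the infimum defining $\|x\|_{\alpha,\varepsilon}$ one has $x'\in b^s_{p_0,\infty}$ and $x''\in b^\alpha_{\infty,\infty}$. For $0<p\le1$, a $p$-seminorm on a complex vector space $X$ is a map $q:X\to[0,+\infty)$ with $q(\lambda x)=|\lambda|q(x)$ and $q(x+y)^p\le q(x)^p+q(y)^p$ for all $x,y\in X$, $\lambda\in\mathbb{C}$; it is a $p$-norm if moreover $q(x)=0$ only for $x=0$. *)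

(* Defs.v *)
(* MathComp-Analysis; complex numbers are R[i] from mathcomp-real-closed. *)
From HB Require Import structures.
From mathcomp Require Import all_boot all_order all_algebra.
From mathcomp Require Import complex.
From mathcomp Require Import all_classical all_reals all_analysis.
From mathcomp Require Import lra ring.
Set Implicit Arguments.
Unset Strict Implicit.
Unset Printing Implicit Defensive.
Import Order.TTheory GRing.Theory Num.Theory.
Import numFieldTopology.Exports numFieldNormedType.Exports.
Local Open Scope classical_set_scope.
Local Open Scope ring_scope.

Definition Lambda := {j : nat & 'I_(2 ^ j)}.

(* R[i]^o is R[i] seen as a complex vector space over itself. *)
Definition Omega (R : realType) := Lambda -> R[i]^o.

Section Sequences.
Context {R : realType}.
Implicit Types (x y : Omega R) (j : nat) (t : R).

(* |x_{j,k}|; normc is the R-valued modulus, `|_| being R[i]-valued. *)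
Definition cabs x j (k : 'I_(2 ^ j)) : R := Normc.normc (x (existT _ j k)).

Definition count_ge x j t : nat := #|[pred k : 'I_(2 ^ j) | t <= cabs x k]|.

(* The value at j = 0, where ln (2 ^ j) = 0, does not affect the limsup. *)
Definition log_count_ratio x (a : R) j : \bar R :=
  lne (count_ge x j (2 `^ (- a * j%:R)))%:R%:E * ((ln (2 ^+ j))^-1)%:E.

Definition asymptotic_profile x (a : R) : \bar R :=
  lim ((fun eps : R => limn_esup (log_count_ratio x (a + eps))) @ 0^'+).

(* 2 ^ (beta j), with 2 ^ (-oo j) = 0 for every j, including j = 0; the
   value for beta = +oo is irrelevant. *)
Definition exp2 (beta : \bar R) j : R :=
  if beta is r%:E then 2 `^ (r * j%:R) else 0.

Definition dist_admissible (alpha : R) (beta : \bar R) x : set R :=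
  [set C | 0 <= C /\ forall j,
    (count_ge x j (C * 2 `^ (- alpha * j%:R)))%:R <= C * exp2 beta j].

Definition d_ (alpha : R) (beta : \bar R) x : \bar R :=
  ereal_inf (EFin @` dist_admissible alpha beta x).

Definition E_set (alpha : R) (beta : \bar R) : set (Omega R) :=
  [set x | d_ alpha beta x < +oo]%E.

Definition besov_norm (sigma p : R) x : \bar R :=
  ereal_sup (range (fun j : nat =>
    (2 `^ ((sigma - p^-1) * j%:R) *
      (\sum_(k < 2 ^ j) cabs x k `^ p) `^ p^-1)%:E)).

Definition besov_norm_inf (sigma : R) x : \bar R :=
  ereal_sup (range (fun j : nat =>
    ereal_sup (range (fun k : 'I_(2 ^ j) =>
      (2 `^ (sigma * j%:R) * cabs x k)%:E)))).

End Sequences.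

Record admissible_profile (R : realType) := AdmissibleProfile {
  profile_fun :> R -> \bar R;
  profile_range : forall a, (profile_fun a = -oo \/ 0 <= profile_fun a <= 1)%E;
  profile_nondecreasing :
    {homo profile_fun : a b / (a <= b)%R >-> (a <= b)%E};
  profile_right_continuous : forall a, profile_fun @ a^'+ --> profile_fun a;
  profile_not_ninfty : exists a, profile_fun a <> -oo%E }.

Section Profiles.
Context {R : realType}.
Implicit Types (nu : R -> \bar R) (a : R).

Definition alpha_min nu : \bar R := ereal_inf [set a%:E | a in [set a | 0 <= nu a]%E].
Definition alpha_max nu : \bar R := ereal_inf [set a%:E | a in [set a | nu a = 1%E]].

Definition right_inf_derivative nu a : \bar R :=
  limf_einf (fun h : R => (nu (a + h)%R - nu a) * (h^-1)%:E)%E 0^'+.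

(* The interval [alpha_min, alpha_max[. *)
Definition alpha_range nu : set R :=
  [set a | alpha_min nu <= a%:E /\ a%:E < alpha_max nu]%E.

Definition p_zero nu : \bar R :=
  mine 1%E (ereal_inf [set right_inf_derivative nu a | a in alpha_range nu]).

Definition S_set nu : set (Omega R) :=
  [set x | forall a, asymptotic_profile x a <= nu a]%E.

(* ||x||_{alpha,eps}, with p playing the role of p_0; nu alpha is a real
   number in [0, 1] for the alpha of interest, alpha in alpha_range nu. *)
Definition interp_norm nu (p alpha eps : R) (x : Omega R) : \bar R :=
  let s := alpha + (1 - fine (nu alpha)) / p - eps in
  ereal_inf [set r | exists x' x'' : Omega R,
    [/\ (besov_norm s p x' < +oo)%E, (besov_norm_inf alpha x'' < +oo)%E,
        x' + x'' = x & r = (besov_norm s p x' + besov_norm_inf alpha x'')%E]].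

End Profiles.

Section CountLemmas.
Context {R : realType}.
Implicit Types (x y z : Omega R) (j : nat) (t : R) (beta : \bar R).

Lemma cabs0 j (k : 'I_(2 ^ j)) : cabs (0 : Omega R) k = 0.
Proof. exact: Normc.normc0. Qed.

Lemma cabs_ge0 x j (k : 'I_(2 ^ j)) : 0 <= cabs x k.
Proof. by rewrite /cabs; case: (x _) => a b /=; exact: sqrtr_ge0. Qed.

Lemma cabsN x j (k : 'I_(2 ^ j)) : cabs (- x) k = cabs x k.
Proof. exact: (@normcN R (x (existT _ j k))). Qed.

Lemma cabsD x y j (k : 'I_(2 ^ j)) : cabs (x + y) k <= cabs x k + cabs y k.
Proof. exact: (@le_normcD R (x (existT _ j k)) (y (existT _ j k))). Qed.

Lemma cabsZ (l : R[i]) x j (k : 'I_(2 ^ j)) :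
  cabs (l *: x) k = Normc.normc l * cabs x k.
Proof. exact: Normc.normcM. Qed.

Lemma cabs_eq0 x : (forall j (k : 'I_(2 ^ j)), cabs x k = 0) -> x = 0.
Proof.
by move=> x0; apply/funext => -[j k]; exact: Normc.eq0_normc (x0 j k).
Qed.

Lemma count_ge_sub x y j s t :
  (forall k : 'I_(2 ^ j), s <= cabs x k -> t <= cabs y k) ->
  (count_ge x j s <= count_ge y j t)%N.
Proof.
by move=> h; apply/subset_leq_card/fintype.subsetP => k; rewrite !inE; exact: h.
Qed.

Lemma count_ge_cover x y z j s t u :
  (forall k : 'I_(2 ^ j), u <= cabs z k -> s <= cabs x k \/ t <= cabs y k) ->
  (count_ge z j u <= count_ge x j s + count_ge y j t)%N.
Proof.
move=> h; rewrite /count_ge -cardUI; apply: leq_trans (leq_addr _ _).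
apply/subset_leq_card/fintype.subsetP => k; rewrite !inE => /h[] -> //.
by rewrite orbT.
Qed.

Lemma count_ge_gt0 x j (k : 'I_(2 ^ j)) t :
  t <= cabs x k -> (0 < count_ge x j t)%N.
Proof. by move=> h; apply/card_gt0P; exists k; rewrite inE. Qed.

Lemma count_ge_eq0 x j t :
  (forall k : 'I_(2 ^ j), cabs x k < t) -> count_ge x j t = 0%N.
Proof.
move=> h; by apply: eq_card0 => k; rewrite !inE leNgt h.
Qed.

Lemma exp2_ge0 beta j : 0 <= exp2 beta j.
Proof. by case: beta => [r| |] //=; exact: powR_ge0. Qed.

Lemma count_geN x j t : count_ge (- x) j t = count_ge x j t.
Proof. by apply: eq_card => k; rewrite !inE cabsN. Qed.

Lemma dist_admissible_le alpha beta x (C D : R) :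
  C <= D -> dist_admissible alpha beta x C -> dist_admissible alpha beta x D.
Proof.
move=> CD [C0 hC]; split; first exact: le_trans CD.
move=> j; apply: (@le_trans _ _ (C * exp2 beta j)); last first.
  by rewrite ler_wpM2r ?exp2_ge0.
apply: le_trans (hC j); rewrite ler_nat; apply: count_ge_sub => k.
by apply: le_trans; rewrite ler_wpM2r ?powR_ge0.
Qed.

Lemma dist_admissibleD alpha beta x y (C D : R) :
  dist_admissible alpha beta x C -> dist_admissible alpha beta y D ->
  dist_admissible alpha beta (x + y) (C + D).
Proof.
move=> [C0 hC] [D0 hD]; split; first exact: addr_ge0.
move=> j; rewrite mulrDl (mulrDl C).
apply: le_trans (lerD (hC j) (hD j)); rewrite -natrD ler_nat.
apply: count_ge_cover => k; set w := 2 `^ _ => hk.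
have [?|Cx] := leP (C * w) (cabs x k); [by left|right].
have [//|Dy] := leP (D * w) (cabs y k).
have := lt_le_trans (le_lt_trans (cabsD _ _ _) (ltrD Cx Dy)) hk.
by rewrite ltxx.
Qed.

Lemma dist_admissibleN alpha beta x (C : R) :
  dist_admissible alpha beta x C -> dist_admissible alpha beta (- x) C.
Proof. by move=> [C0 hC]; split => // j; rewrite count_geN. Qed.

Lemma dist_admissible0 alpha beta (C : R) :
  0 < C -> dist_admissible alpha beta 0 C.
Proof.
move=> C0; split; first exact: ltW.
move=> j; rewrite count_ge_eq0 ?mulr_ge0 ?exp2_ge0 ?ltW // => k.
by rewrite cabs0 mulr_gt0 ?powR_gt0.
Qed.

Lemma d__ge0 alpha beta x : (0 <= d_ alpha beta x)%E.
Proof. by apply: le_ereal_inf_tmp => _ [C [C0 _] <-]; rewrite lee_fin. Qed.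

Lemma d__lt alpha beta x (r : R) : (d_ alpha beta x < r%:E)%E ->
  dist_admissible alpha beta x r.
Proof.
move=> /ereal_inf_lt[_ [C hC <-]]; rewrite lte_fin => Cr.
exact: dist_admissible_le (ltW Cr) hC.
Qed.

Lemma d__le alpha beta x (r : R) : dist_admissible alpha beta x r ->
  (d_ alpha beta x <= r%:E)%E.
Proof. by move=> hr; apply: ereal_inf_lbound; exists r. Qed.

Lemma E_setP alpha beta x :
  E_set alpha beta x <-> exists C, dist_admissible alpha beta x C.
Proof.
split=> [/ereal_inf_lt[_ [C hC <-] _]|[C hC]]; first by exists C.
exact: le_lt_trans (d__le hC) (ltry _).
Qed.

Lemma E_setB alpha beta x y :
  E_set alpha beta x -> E_set alpha beta y -> E_set alpha beta (x - y).
Proof.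
move=> /E_setP[C hC] /E_setP[D hD]; apply/E_setP; exists (C + D).
exact/dist_admissibleD/dist_admissibleN.
Qed.

Lemma d__fin_num alpha beta x : E_set alpha beta x -> d_ alpha beta x \is a fin_num.
Proof. by move=> hx; rewrite ge0_fin_numE ?d__ge0. Qed.

Lemma d__0 alpha beta : d_ alpha beta (0 : Omega R) = 0%E.
Proof.
apply/eqP; rewrite eq_le d__ge0 andbT; apply/lee_addgt0Pr => e e0.
by rewrite add0e; apply/d__le/dist_admissible0.
Qed.

Lemma d__N alpha beta x : d_ alpha beta (- x) = d_ alpha beta x.
Proof.
congr (ereal_inf (EFin @` _)); apply/seteqP; split=> C.
  by move/dist_admissibleN; rewrite opprK.
exact: dist_admissibleN.
Qed.

Lemma d__D alpha beta x y : E_set alpha beta x -> E_set alpha beta y ->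
  (d_ alpha beta (x + y)%R <= d_ alpha beta x + d_ alpha beta y)%E.
Proof.
move=> hx hy; apply/lee_addgt0Pr => e e0.
have H z : E_set alpha beta z ->
    dist_admissible alpha beta z (fine (d_ alpha beta z) + e / 2).
  move=> hz; apply: d__lt; rewrite EFinD fineK ?d__fin_num //.
  by rewrite lteDl ?d__fin_num // lte_fin divr_gt0.
apply: le_trans (d__le (dist_admissibleD (H _ hx) (H _ hy))) _.
rewrite addrACA -splitr 2!EFinD !fineK ?d__fin_num //.
Qed.

Lemma d__eq0 alpha beta x : d_ alpha beta x = 0%E -> x = 0.
Proof.
move=> d0; apply: cabs_eq0 => j k; apply/eqP.
rewrite -[_ == _]negbK; apply/negP => xk0.
have xk : 0 < cabs x k by rewrite lt0r xk0 cabs_ge0.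
pose w := 2 `^ (- alpha * j%:R) : R; have w0 : 0 < w by rewrite powR_gt0.
pose C := Num.min (cabs x k / w) ((exp2 beta j + 1)^-1).
have b1 : 0 < exp2 beta j + 1 by rewrite ltr_wpDl ?exp2_ge0.
have C0 : 0 < C by rewrite lt_min divr_gt0 //= invr_gt0.
have [_ /(_ j)] : dist_admissible alpha beta x C.
  by apply: d__lt; rewrite d0 lte_fin.
apply/negP; rewrite -ltNge; apply: (@lt_le_trans _ _ 1).
  apply: (@le_lt_trans _ _ ((exp2 beta j + 1)^-1 * exp2 beta j)).
    by rewrite ler_wpM2r ?exp2_ge0 // ge_min lexx orbT.
  by rewrite mulrC ltr_pdivrMr // mul1r ltrDl.
rewrite ler1n; apply: (count_ge_gt0 (k := k)).
by rewrite -ler_pdivlMr // ge_min lexx.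
Qed.

End CountLemmas.

Definition E_space (R : realType) (alpha : R) (beta : \bar R) : Type :=
  {x : Omega R | x \in E_set alpha beta}.

HB.instance Definition _ (R : realType) (alpha : R) (beta : \bar R) :=
  Choice.on (E_space alpha beta).

Section E_metric.
Context {R : realType} {alpha : R} {beta : \bar R}.
Implicit Types u v w : E_space alpha beta.

Definition E_dist u v : R := fine (d_ alpha beta (sval u - sval v)).

Let subE u v : E_set alpha beta (sval u - sval v).
Proof. by apply: E_setB; apply: set_mem; [case: u|case: v]. Qed.

Lemma E_dist_refl u : E_dist u u = 0.
Proof. by rewrite /E_dist subrr d__0. Qed.

Lemma E_dist_eq0 u v : E_dist u v = 0 -> u = v.
Proof.
move=> uv0; have /eqP : sval u - sval v = 0.
  by apply: (@d__eq0 _ alpha beta); rewrite -[LHS]fineK ?d__fin_num // -/(E_dist _ _) uv0.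
by rewrite subr_eq0 => /eqP uv; exact: val_inj.
Qed.

Lemma E_dist_sym u v : E_dist u v = E_dist v u.
Proof. by rewrite /E_dist -d__N opprB. Qed.

Lemma E_dist_triangle v u w : E_dist u w <= E_dist u v + E_dist v w.
Proof.
rewrite -lee_fin EFinD !fineK ?d__fin_num //.
by rewrite -(subrKA (sval v)); exact: d__D.
Qed.

HB.instance Definition _ := @isMetric.Build R (E_space alpha beta)
  E_dist E_dist_refl E_dist_eq0 E_dist_sym E_dist_triangle.

End E_metric.

Section SpaceLemmas.
Context {R : realType}.
Implicit Types (x y : Omega R) (j : nat) (a b : R) (nu : R -> \bar R).

Lemma pow2E a j : (2 ^+ j) `^ a = 2 `^ (a * j%:R) :> R.
Proof. by rewrite -powR_mulrn ?ler0n // -powRrM mulrC. Qed.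

Lemma log_count_ratio_le x a b j : (0 < j)%N ->
  (log_count_ratio x a j <= b%:E)%E =
  ((count_ge x j (2 `^ (- a * j%:R)))%:R <= 2 `^ (b * j%:R)).
Proof.
move=> j0; rewrite /log_count_ratio.
set n : R := (count_ge _ _ _)%:R.
have l0 : 0 < ln (2 ^+ j) :> R by rewrite ln_gt0 // exprn_egt1 ?ltr1n // -lt0n.
have n0 : 0 <= n by rewrite ler0n.
rewrite lee_pdivrMr // -EFinM.
have [n00|np] := leP n 0.
  have /eqP -> : n == 0 by rewrite eq_le n00 n0.
  by rewrite /= lexx leNye powR_ge0.
rewrite lne_EFin // lee_fin -pow2E /powR expf_eq0 pnatr_eq0 andbF.
by rewrite -[in RHS](lnK np) ler_expR.
Qed.

Lemma limn_esup_le (u : (\bar R)^nat) (l : \bar R) :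
  (\forall j \near \oo, (u j <= l)%E) -> (limn_esup u <= l)%E.
Proof.
move=> [N _ hN]; apply: (@le_trans _ _ (ereal_sup (u @` [set j | (N <= j)%N]))).
  apply: ereal_inf_lbound; exists [set j | (N <= j)%N] => //.
  exact: nbhs_infty_ge.
by apply: ge_ereal_sup => _ [j Nj <-]; exact: hN.
Qed.

Lemma limn_esup_lt (u : (\bar R)^nat) (l : \bar R) :
  (limn_esup u < l)%E -> \forall j \near \oo, (u j <= l)%E.
Proof.
move=> /ereal_inf_lt[_ [V [N _ hN] <-] Vl]; exists N => // j Nj.
by apply: le_trans (ltW Vl); apply: ereal_sup_ubound; exists j => //; exact: hN.
Qed.

Lemma asymptotic_profileE x a : asymptotic_profile x a =
  ereal_inf [set limn_esup (log_count_ratio x (a + eps)) | eps in `]0, +oo[].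
Proof.
apply: cvg_lim; first exact: ereal_hausdorff.
apply: (@nondecreasing_at_right_cvge R
  (fun e => limn_esup (log_count_ratio x (a + e))) 0 +oo%O); first by [].
move=> e1 e2 _ _ e12.
rewrite [leRHS]limf_esupE.
apply: le_ereal_inf_tmp => _ [V FV <-].
apply: (@le_trans _ _ (ereal_sup (log_count_ratio x (a + e1) @` V))).
  by apply: ereal_inf_lbound; exists V.
apply: ge_ereal_sup => _ [j Vj <-].
apply: (@le_trans _ _ (log_count_ratio x (a + e2) j)); last first.
  by apply: ereal_sup_ubound; exists j.
rewrite /log_count_ratio lee_wpmul2r ?lee_fin ?invr_ge0 ?ln_ge0 ?exprn_ege1 ?ler1n //.
rewrite lee_lne ?in_itv/= ?leey ?lee_fin ?ler0n//.
rewrite ler_nat.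
apply: count_ge_sub => k; apply: le_trans.
by rewrite ler_powR ?ler1n // ler_wpM2r // lerN2 lerD2l.
Qed.

Lemma S_setP nu x : S_set nu x <-> forall a b, (nu a < b%:E)%E ->
  exists2 eps : R, 0 < eps & \forall j \near \oo,
    (count_ge x j (2 `^ (- (a + eps) * j%:R)))%:R <= 2 `^ (b * j%:R).
Proof.
split=> [xS a b ab|H a].
  have := le_lt_trans (xS a) ab; rewrite asymptotic_profileE.
  move=> /ereal_inf_lt[_ [e e0 <-] fb]; have [N _ hN] := limn_esup_lt fb.
  move: e0; rewrite /= in_itv/= andbT => e0; exists e => //; exists N.+1 => // j /= Nj.
  by rewrite -log_count_ratio_le ?(leq_trans _ Nj) //; apply: hN; apply: ltnW.
have {}H b : (nu a < b%:E)%E -> (asymptotic_profile x a <= b%:E)%E.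
  move=> /H[e e0 [N _ hN]]; rewrite asymptotic_profileE.
  apply: (@le_trans _ _ (limn_esup (log_count_ratio x (a + e)))).
    by apply: ereal_inf_lbound; exists e => //; rewrite /= in_itv/= e0.
  apply: limn_esup_le; exists N.+1 => // j /= Nj.
  by rewrite log_count_ratio_le ?(leq_trans _ Nj) //; apply: hN; apply: ltnW.
case: (nu a) H => [r| |] H; last 2 first.
- exact: leey.
- case: (asymptotic_profile x a) H => [r| |] // H; last by have := H 0; rewrite ltNyr => /(_ isT).
  by have := H (r - 1 : R); rewrite ltNyr lee_fin lerBrDr gerDl ler10 => /(_ isT).
by apply/lee_addgt0Pr => e e0; rewrite -EFinD H // lte_fin ltrDl.
Qed.

Lemma powR2_split (a d e t : R) :
  2 `^ (- (a + e) * t) = 2 `^ ((d - e) * t) * 2 `^ (- (a + d) * t).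
Proof.
have -> : - (a + e) = (d - e) + - (a + d) by ring.
by rewrite mulrDl powRD // pnatr_eq0 implybT.
Qed.

Lemma near_powM2 (c e : R) : 0 < e -> \forall j \near \oo, c <= 2 `^ (e * j%:R).
Proof.
move=> e0; have l2 : 0 < ln 2 :> R by rewrite ln_gt0 // ltr1n.
near=> j; apply: (@le_trans _ _ (1 + e * j%:R * ln 2)).
  rewrite -lerBlDl -ler_pdivrMr // -ler_pdivrMl //.
  by near: j; exact: nbhs_infty_ger.
by rewrite /powR pnatr_eq0 /= expR_ge1Dx.
Unshelve. all: end_near. Qed.

Lemma S_set_submod_closed nu : submod_closed (mem (S_set nu) : {pred Omega R}).
Proof.
split.
  apply/mem_set/S_setP => a b _; exists 1 => //; near=> j.
  rewrite count_ge_eq0 ?powR_ge0 // => k.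
  by rewrite cabs0 powR_gt0.
move=> l x y /set_mem/S_setP xS /set_mem/S_setP yS; apply/mem_set/S_setP => a b ab.
have [b' ab' b'b] : exists2 b', (nu a < b'%:E)%E & b' < b.
  case: (nu a) ab => [r| |] //=.
    by rewrite lte_fin => rb; exists ((r + b) / 2); rewrite ?lte_fin midf_lt.
  by move=> _; exists (b - 1); rewrite ?ltNyr // ltrBlDr ltrDl.
have [e1 e10 h1] := xS _ _ ab'.
have [e2 e20 h2] := yS _ _ ab'.
pose e := Num.min e1 e2; have e0 : 0 < e by rewrite lt_min e10.
have n0 : 0 <= Normc.normc l by case: (l) => ? ? /=; exact: sqrtr_ge0.
exists (e / 2); first by rewrite divr_gt0.
near=> j.
have g1 : (count_ge x j (2 `^ (- (a + e1) * j%:R)))%:R <= 2 `^ (b' * j%:R).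
  by near: j.
have g2 : (count_ge y j (2 `^ (- (a + e2) * j%:R)))%:R <= 2 `^ (b' * j%:R).
  by near: j.
pose w (d : R) : R := 2 `^ (- (a + d) * j%:R).
have wE d : w (e / 2) = 2 `^ ((d - e / 2) * j%:R) * w d.
  exact: powR2_split.
have cw d : e <= d -> (Normc.normc l + Normc.normc l + 2) <= 2 `^ ((d - e / 2) * j%:R).
  move=> ed; apply: (@le_trans _ _ (2 `^ ((e / 2) * j%:R))).
    by near: j; apply: near_powM2; rewrite divr_gt0.
  by rewrite ler_powR ?ler1n // ler_wpM2r // lerBrDl -splitr.
have [c1 c2] : e <= e1 /\ e <= e2 by rewrite /e !ge_min !lexx orbT.
apply: (@le_trans _ _ (2 `^ (b' * j%:R) + 2 `^ (b' * j%:R))); last first.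
  rewrite -(subrK b' b) mulrDl powRD ?pnatr_eq0 ?implybT //.
  rewrite -mulr2n -[X in X <= _]mulr_natl ler_wpM2r ?powR_ge0 //.
  by near: j; apply: near_powM2; rewrite subr_gt0.
apply: (@le_trans _ _ ((count_ge x j (w e1))%:R + (count_ge y j (w e2))%:R)); last first.
  exact: lerD g1 g2.
rewrite -natrD ler_nat; apply: count_ge_cover => k hk.
have [?|xk] := leP (w e1) (cabs x k); [by left|right].
have [//|yk] := leP (w e2) (cabs y k).
have := le_trans hk (cabsD _ _ _); rewrite cabsZ -/(w (e / 2)).
have p1 := cw _ c1; have p2 := cw _ c2.
have w10 : 0 < w e1 by rewrite powR_gt0.
have w20 : 0 < w e2 by rewrite powR_gt0.
have q1 : (Normc.normc l + Normc.normc l + 2) * w e1 <= w (e / 2).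
  by rewrite (wE e1) ler_wpM2r // ltW.
have q2 : (Normc.normc l + Normc.normc l + 2) * w e2 <= w (e / 2).
  by rewrite (wE e2) ler_wpM2r // ltW.
have x0 := cabs_ge0 x k; move: n0 q1 q2 x0 xk yk w10 w20.
move: (Normc.normc l) (w e1) (w e2) (w (e / 2)) (cabs x k) (cabs y k).
clear -R => l w1 w2 w3 x y l0 q1 q2 x0 xw yw w10 w20 h.
have lx : l * x <= l * w1 by rewrite ler_wpM2l // ltW.
have A0 : 0 <= l * w1 by rewrite mulr_ge0 // ltW.
have B0 : 0 <= l * w2 by rewrite mulr_ge0 // ltW.
move: q1 q2 h lx A0 B0; rewrite !mulrDl.
move: (l * x) (l * w1) (l * w2) => lx lw1 lw2; lra.
Unshelve. all: end_near. Qed.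

Lemma S_set_subset_E (nu : admissible_profile R) a (e : R) : 0 < e ->
  S_set nu `<=` E_set a (nu a + e%:E)%E.
Proof.
move=> e0 x xS0; have xS := (S_setP nu x).1 xS0.
have [N hN] : exists N, forall j, (N <= j)%N ->
    (count_ge x j (2 `^ (- a * j%:R)))%:R <= exp2 (nu a + e%:E)%E j.
  have M (d : R) j : 0 < d -> (count_ge x j (2 `^ (- a * j%:R)))%:R <=
      (count_ge x j (2 `^ (- (a + d) * j%:R)))%:R :> R.
    move=> d0; rewrite ler_nat; apply: count_ge_sub => k; apply: le_trans.
    by rewrite ler_powR ?ler1n // ler_wpM2r // lerN2 lerDl ltW.
  move: (xS a); case: (profile_range nu a) => [->|].
    move=> xSa; have [d d0 [N _ hN]] := xSa (-1 : R) (ltNyr _); exists N.+1 => j Nj.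
    rewrite /= (_ : count_ge _ _ _ = 0%N) //; apply/eqP.
    rewrite -leqn0 -ltnS -(ltr_nat R); apply: le_lt_trans (M _ _ d0) _.
    apply: le_lt_trans (hN _ (ltnW Nj)) _.
    rewrite mulN1r powRN powR_mulrn // invf_lt1 ?exprn_gt0 //.
    by rewrite exprn_egt1 ?ltr1n // -lt0n (leq_trans _ Nj).
  move=> /andP[]; case: (nu a) => [r| |] // _ _ xSa.
  have [|d d0 [N _ hN]] := xSa (r + e); first by rewrite lte_fin ltrDl.
  exists N => j Nj.
  exact: le_trans (M _ _ d0) (hN _ Nj).
apply/E_setP.
pose s j : R := \sum_(k < 2 ^ j) cabs x k * 2 `^ (a * j%:R).
have s0 j : 0 <= s j.
  by apply: sumr_ge0 => k _; rewrite mulr_ge0 ?powR_ge0 ?cabs_ge0.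
have sum0 : 0 <= \sum_(j < N) s j by apply: sumr_ge0.
exists (1 + \sum_(j < N) s j); split; first exact: addr_ge0.
move=> j; have [jN|Nj] := ltnP j N.
  rewrite count_ge_eq0 ?mulr_ge0 ?exp2_ge0 ?addr_ge0 // => k.
  rewrite mulNr powRN -ltr_pdivrMr ?invr_gt0 ?powR_gt0 // invrK.
  apply: (@le_lt_trans _ _ (\sum_(j < N) s j)); last by rewrite ltrDr.
  rewrite (bigD1 (Ordinal jN)) //=; apply: ler_wpDr; first exact: sumr_ge0.
  rewrite /s (bigD1 k) //=; apply: ler_wpDr => //.
  by apply: sumr_ge0 => i _; rewrite mulr_ge0 ?powR_ge0 ?cabs_ge0.
apply: (@le_trans _ _ (exp2 (nu a + e%:E)%E j)); last first.
  by rewrite ler_peMl ?exp2_ge0 // lerDl.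
apply: le_trans (hN _ Nj); rewrite ler_nat; apply: count_ge_sub => k.
by apply: le_trans; rewrite ler_peMl ?powR_ge0 // lerDl.
Qed.

End SpaceLemmas.

Definition S_pred (R : realType) (nu : R -> \bar R) : {pred Omega R} :=
  mem (S_set nu).

Definition S_space (R : realType) (nu : R -> \bar R) : Type :=
  {x : Omega R | x \in S_pred nu}.

HB.instance Definition _ (R : realType) (nu : R -> \bar R) :=
  SubChoice.on (S_space nu).

HB.instance Definition _ (R : realType) (nu : R -> \bar R) :=
  GRing.isSubmodClosed.Build R[i] (Omega R) (S_pred nu)
    (S_set_submod_closed nu).

HB.instance Definition _ (R : realType) (nu : R -> \bar R) :=
  [SubChoice_isSubLmodule of S_space nu by <:].

Section Topologies.
Context {R : realType}.

Definition S_incl (nu : admissible_profile R) (a : R) (e : {posnum R})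
    (x : S_space nu) : E_space a (nu a + e%:num%:E)%E :=
  exist _ (val x)
    (mem_set (S_set_subset_E a (gt0 e) (set_mem (valP x)))).

(* The coarsest topology on S^nu making every inclusion into
   E(a_n, nu(a_n) + e_m) continuous. *)
Definition S_topology (nu : admissible_profile R) (a : nat -> R)
    (e : nat -> {posnum R}) : Type :=
  sup_topology (fun nm : nat * nat =>
    Topological.on (initial_topology (@S_incl nu (a nm.1) (e nm.2)))).

HB.instance Definition _ (nu : admissible_profile R) a e :=
  Topological.on (@S_topology nu a e).

Definition is_pnorm (X : lmodType R[i]) (p : R) (q : X -> R) : Prop :=
  [/\ 0 < p <= 1, forall x, 0 <= q x,
      forall (l : R[i]) x, q (l *: x) = Normc.normc l * q x,
      forall x y, q (x + y) `^ p <= q x `^ p + q y `^ p &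
      forall x, q x = 0 -> x = 0].

(* The balls of a p-seminorm q are those of the translation-invariant
   pseudometric q (x - y) `^ p, so F induces the topology they generate. *)
Definition pnorm_topology (X : lmodType R[i]) (F : set (X -> R)) : Type := X.

Definition pnorm_balls (X : lmodType R[i]) (F : set (X -> R)) : set (set X) :=
  [set U | exists q y (r : R), [/\ F q, 0 < r & U = [set x | q (x - y) < r]]].

Section PnormTopology.
Variables (X : lmodType R[i]) (F : set (X -> R)).
HB.instance Definition _ := Choice.on (pnorm_topology F).
HB.instance Definition _ :=
  isSubBaseTopological.Build (pnorm_topology F) (pnorm_balls F) id.
End PnormTopology.

Definition S_open (nu : admissible_profile R) (a : nat -> R)
    (e : nat -> {posnum R}) : set (set (S_space nu)) :=
  @open (@S_topology nu a e).

Definition pnorm_open (X : lmodType R[i]) (F : set (X -> R)) : set (set X) :=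
  @open (pnorm_topology F).

Variable nu : admissible_profile R.

Definition S_besov_norm_inf (eps : R) (x : S_space nu) : \bar R :=
  besov_norm_inf (fine (alpha_min nu) - eps) (val x).

Definition S_interp_norm (alpha eps : R) (x : S_space nu) : \bar R :=
  interp_norm nu (fine (p_zero nu)) alpha eps (val x).

Definition norm_family (A B : set R) : set (S_space nu -> R) :=
  [set fine \o S_besov_norm_inf eps | eps in B] `|`
  [set fine \o S_interp_norm ae.1 ae.2 | ae in A `*` B].

End Topologies.

Arguments S_open {R} nu a e.
Arguments S_besov_norm_inf {R} nu eps x.
Arguments S_interp_norm {R} nu alpha eps x.
Arguments norm_family {R} nu A B.

(* Main.v *)
(* Both topologies are compared through their neighbourhoods of 0.

   If x is small for d_{b_i, nu(b_i) + e} at finitely many closely spaced levels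
   b_0 < alpha_min, ..., b_L slightly above alpha, let x' collect the
   coefficients with |x_{j,k}| >= C 2^(-b_L j).  Those lying between levels i
   and i+1 contribute at most C^(1+p) 2^((nu(b_{i+1}) + e - p b_i) j) to the sum
   of the |x'_{j,k}|^p, p = p_0; as nu grows at least with slope p below
   alpha_max, the exponent is at most that at alpha up to an arbitrarily small
   error, which eps absorbs.  So x' is small in b^s_{p, oo}, and x - x' is small
   in b^alpha_{oo, oo}.

   Conversely, Markov's inequality applied to x' bounds the counts in d_{a, beta}
   when alpha is slightly above a in [alpha_min, alpha_max[; for the other a the
   norms of b^(alpha_min - eps)_{oo, oo} suffice. *)
Require Import Defs.
From HB Require Import structures.
From mathcomp Require Import all_boot all_order all_algebra.
From mathcomp Require Import complex finmap.
From mathcomp Require Import all_classical all_reals all_analysis.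
From mathcomp Require Import lra ring.
Set Implicit Arguments.
Unset Strict Implicit.
Unset Printing Implicit Defensive.
Import Order.TTheory GRing.Theory Num.Theory.
Import numFieldTopology.Exports numFieldNormedType.Exports.
Local Open Scope classical_set_scope.
Local Open Scope ring_scope.

(** * Neighbourhoods in the two topologies *)

Section PnormNbhs.
Context {R : realType} (X : lmodType R[i]) (F : set (X -> R)).

(** A neighbourhood of [t] contains a finite intersection of subbasic balls through [t], and a
    filter is closed under finite intersections. These balls may have any centre, hence the free
    [y]. *)
Lemma pnorm_topology_cvg (G : set_system X) (t : X) : Filter G ->
  (forall q y r, F q -> 0 < r -> q (t - y) < r -> G [set x | q (x - y) < r]) ->
  G --> (t : pnorm_topology F).
Proof.
move=> FG h A At; rewrite nbhs_filterE.
have /= E := @nbhsE (pnorm_topology F) t; move: At; rewrite E.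
move=> [_ [[B sB <-] [C BC Ct] sUBA]].
apply: filterS sUBA _; apply: (@filterS _ _ _ C); first by move=> ? ?; exists C.
have [D sD IDeC] := sB _ BC; rewrite -IDeC; apply: filter_bigI => U DU.
have := sD _ DU; rewrite inE; case=> q [y [r [Fq r0 UE]]].
move: Ct; rewrite -IDeC => /(_ _ DU); rewrite UE => Ct.
exact: h.
Qed.

Lemma pnorm_ball_open q y r : F q -> 0 < r ->
  @open (pnorm_topology F) [set x | q (x - y) < r].
Proof.
move=> Fq r0; exists [set [set x | q (x - y) < r]]; last by rewrite bigcup_set1.
move=> _ ->; exists [fset [set x | q (x - y) < r]]%fset; last by rewrite set_fset1 bigcap_set1.
by move=> U /fset1P ->; rewrite inE; exists q, y, r.
Qed.

End PnormNbhs.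

Section StopologyNbhs.
Context {R : realType} (nu : admissible_profile R) (a : nat -> R)
  (e : nat -> {posnum R}).

(** Convergence in a supremum of initial topologies can be tested on one inclusion at a time, and
    there on metric balls. *)
Lemma S_topology_cvg (G : set_system (S_space nu)) (t : S_space nu) : Filter G ->
  (forall n m (r : R), 0 < r ->
     G [set x | (d_ (a n) (nu (a n) + (e m)%:num%:E) (val (x - t)%R) < r%:E)%E]) ->
  G --> (t : S_topology nu a e).
Proof.
move=> FG h; apply/cvg_sup => -[n m] U /=.
have /= -> := @nbhsE (initial_topology (@S_incl R nu (a n) (e m))) t.
case=> _ [[C oC <-] Ct] sU; apply: filterS sU _.
have /nbhs_ballP[r /= r0 rC] : nbhs (S_incl (a n) (e m) t) C.
  by apply: open_nbhs_nbhs.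
apply: filterS (h n m r r0) => x /= xr; apply: rC.
apply: ball_sym; rewrite ballEmdist /=.
rewrite -lte_fin; apply: le_lt_trans xr.
rewrite /mdist/= /E_dist fineK //.
exact/d__fin_num/E_setB/set_mem/(valP (S_incl (a n) (e m) t))/set_mem/(valP (S_incl (a n) (e m) x)).
Qed.

Lemma S_topology_nbhs (t : S_space nu) n m (r : R) : 0 < r ->
  @nbhs _ (S_topology nu a e) t
    [set x | (d_ (a n) (nu (a n) + (e m)%:num%:E) (val (x - t)%R) < r%:E)%E].
Proof.
move=> r0.
have : nbhs (t : S_topology nu a e) --> (t : S_topology nu a e) by [].
move=> /cvg_sup /(_ (n, m)); apply => /=.
have := @initial_continuous (S_space nu) _ (@S_incl R nu (a n) (e m)) t.
move=> /(_ _ (nbhsx_ballx _ r r0)) /=.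
rewrite !nbhs_simpl /=; apply: filterS => x /=.
move/ball_sym; rewrite ballEmdist /= -lte_fin /mdist /= /E_dist fineK //.
exact/d__fin_num/E_setB/set_mem/(valP (S_incl (a n) (e m) t))/set_mem/(valP (S_incl (a n) (e m) x)).
Qed.

End StopologyNbhs.

(** * Power inequalities and p-norms *)

Section PnormTools.
Context {R : realType}.
Implicit Types (a b c d p r s t : R).

Lemma normc_ge0 (l : R[i]) : 0 <= Normc.normc l.
Proof. by case: l => u v /=; exact: sqrtr_ge0. Qed.

Lemma powRVK p a : p != 0 -> 0 <= a -> (a `^ p^-1) `^ p = a.
Proof. by move=> p0 a0; rewrite -powRrM mulVf // powRr1. Qed.

Lemma powRKV p a : p != 0 -> 0 <= a -> (a `^ p) `^ p^-1 = a.
Proof. by move=> p0 a0; rewrite -powRrM mulfV // powRr1. Qed.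

Lemma le01_powR p a : 0 < p <= 1 -> 0 <= a <= 1 -> a <= a `^ p.
Proof.
move=> /andP[p0 p1] /andP[]; rewrite le_eqVlt => /predU1P[<- _|a0 a1].
  by rewrite powR0 // gt_eqF.
by apply: ger1_powR => //; rewrite a0.
Qed.

(** The ratios of [a] and [b] to [a + b] lie in [0, 1], where u <= u^p, and they add up to 1. *)
Lemma powR_subadditive p a b : 0 < p <= 1 -> 0 <= a -> 0 <= b ->
  (a + b) `^ p <= a `^ p + b `^ p.
Proof.
move=> p01 a0 b0; have [p0 p1] := andP p01.
have [/eqP|ab] := eqVneq (a + b) 0.
  by rewrite paddr_eq0 // => /andP[/eqP-> /eqP->]; rewrite addr0 powR0 ?gt_eqF.
have ab0 : 0 < a + b by rewrite lt0r ab addr_ge0.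
have H c : 0 <= c <= a + b -> c / (a + b) * (a + b) `^ p <= c `^ p.
  move=> /andP[c0 cab]; have u0 : 0 <= c / (a + b) by rewrite divr_ge0 // ltW.
  rewrite -[in leRHS](divfK ab c) (powRM _ u0 (ltW ab0)) ler_wpM2r ?powR_ge0 //.
  by apply: le01_powR; rewrite // u0 /= ler_pdivrMr // mul1r.
apply: le_trans (lerD (H a _) (H b _)); rewrite ?a0 ?b0 ?lerDl ?lerDr //.
by rewrite -mulrDl -mulrDl mulfV // mul1r.
Qed.

(** This is convexity of u^(1/p) at the points a^p and b^p, raised to the power p. *)
Lemma powR_concave p t a b : 0 < p <= 1 -> 0 <= t <= 1 -> 0 <= a -> 0 <= b ->
  t * a `^ p + (1 - t) * b `^ p <= (t * a + (1 - t) * b) `^ p.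
Proof.
move=> /andP[p0 p1] /andP[t0 t1] a0 b0; have pN0 : p != 0 by rewrite gt_eqF.
have ip : 1 <= p^-1 by rewrite invr_ge1 ?unitfE.
have s0 : 0 <= 1 - t by rewrite subr_ge0.
have := convex_powR ip (Itv01 t0 t1) (x := a `^ p) (y := b `^ p).
rewrite !inE /= !in_itv /= !powR_ge0 => /(_ isT isT).
rewrite !convRE /= !powRKV //.
rewrite /unstable.onem => h.
have {1}-> : t * a `^ p + (1 - t) * b `^ p =
   ((t * a `^ p + (1 - t) * b `^ p) `^ p^-1) `^ p.
  by rewrite powRVK // addr_ge0 // mulr_ge0 // powR_ge0.
by apply: ge0_ler_powR; rewrite ?nnegrE ?powR_ge0 ?addr_ge0 ?mulr_ge0 // ltW.
Qed.

(* The reason why the infimum of (p-norm + norm) over all splittings is a p-norm. *)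
Lemma powR_reverse_minkowski p a b c d : 0 < p <= 1 ->
  0 <= a -> 0 <= b -> 0 <= c -> 0 <= d ->
  ((a `^ p + c `^ p) `^ p^-1 + (b + d)) `^ p <= (a + b) `^ p + (c + d) `^ p.
Proof.
move=> p01 a0 b0 c0 d0; have [p0 p1] := andP p01.
have pN0 : p != 0 by rewrite gt_eqF.
set A := _ `^ p^-1; set B := b + d.
have Ap : A `^ p = a `^ p + c `^ p by rewrite powRVK // addr_ge0 ?powR_ge0.
have A_ge0 : 0 <= A by exact: powR_ge0.
have B_ge0 : 0 <= B by exact: addr_ge0.
have [A0|AN0] := eqVneq A 0.
  have /eqP : a `^ p + c `^ p = 0 by rewrite -Ap A0 powR0.
  rewrite paddr_eq0 ?powR_ge0 // !powR_eq0 !pN0 !andbT => /andP[/eqP-> /eqP->].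
  by rewrite A0 !add0r; exact: powR_subadditive.
have [/eqP|BN0] := eqVneq B 0.
  by rewrite paddr_eq0 // => /andP[/eqP b00 /eqP d00]; rewrite /B b00 d00 !addr0 Ap.
have A0 : 0 < A by rewrite lt0r AN0.
have B0 : 0 < B by rewrite lt0r BN0.
have AB : 0 < A + B by rewrite addr_gt0.
pose t := A / (A + B).
have t01 : 0 <= t <= 1.
  by rewrite divr_ge0 ?(ltW AB) //= ler_pdivrMr // mul1r lerDl.
have tE : 1 - t = B / (A + B) by rewrite /t; field; rewrite gt_eqF.
(* [u + v] is [A + B] times the mean of [u / A] and [v / B] with weights [t] and [1 - t]. Concavity
   applies, and the power on [v / B] is dropped because [v / B <= 1]. Summed over (a, b) and (c, d),
   the normalized terms (u/A)^p and v/B each give 1. *)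
have H u v : 0 <= u -> 0 <= v -> v <= B ->
    (A + B) `^ p * (t * (u `^ p / A `^ p) + (1 - t) * (v / B)) <= (u + v) `^ p.
  move=> u0 v0 vB.
  have -> : u + v = (A + B) * (t * (u / A) + (1 - t) * (v / B)).
    by rewrite tE /t; field; rewrite !gt_eqF.
  have uA : 0 <= u / A by rewrite divr_ge0 // ltW.
  have vB0 : 0 <= v / B by rewrite divr_ge0 // ltW.
  have [t0 t1] := andP t01.
  have s0 : 0 <= 1 - t by rewrite subr_ge0.
  have w0 : 0 <= t * (u / A) + (1 - t) * (v / B).
    by apply: addr_ge0; apply: mulr_ge0.
  rewrite [leRHS](powRM _ (ltW AB) w0).
  rewrite ler_wpM2l ?powR_ge0 //.
  apply: le_trans (powR_concave p01 t01 uA vB0).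
  have -> : u `^ p / A `^ p = (u / A) `^ p.
    by rewrite -[in LHS](divfK AN0 u) powRM // mulfK // (lt0r_neq0 (powR_gt0 _ A0)).
  rewrite lerD2l ler_wpM2l //; apply: le01_powR => //.
  by rewrite vB0 /= ler_pdivrMr // mul1r.
apply: le_trans (lerD (H a b _ _ _) (H c d _ _ _)); rewrite ?lerDl ?lerDr //.
rewrite -mulrDr ler_peMr ?powR_ge0 //.
rewrite addrACA -!mulrDr -!mulrDl -Ap mulfV ?(lt0r_neq0 (powR_gt0 _ A0)) //.
by rewrite mulfV // !mulr1 subrKC.
Qed.

(** An infimum over splittings need not be attained, so homogeneity and the triangle inequality are
    assumed only in terms of strict upper bounds [r] and [t]. Letting these decrease to the values
    of [q] gives the exact relations. *)
Lemma gauge_pnorm (X : lmodType R[i]) p (q : X -> \bar R) : 0 < p <= 1 ->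
  (forall x, (0 <= q x < +oo)%E) ->
  (forall l x r, (q x < r%:E -> q (l *: x)%R <= (Normc.normc l * r)%:E)%E) ->
  (forall x y r t, (q x < r%:E -> q y < t%:E ->
     q (x + y)%R <= ((r `^ p + t `^ p) `^ p^-1)%:E)%E) ->
  (forall x, q x = 0%E -> x = 0) ->
  is_pnorm p (fine \o q).
Proof.
move=> p01 q0 qZ qD qE0; have [p0 p1] := andP p01.
have pN0 : p != 0 by rewrite gt_eqF.
have qf x : q x \is a fin_num.
  by have /andP[? ?] := q0 x; rewrite ge0_fin_numE.
have f0 x : 0 <= fine (q x) by rewrite fine_ge0 //; have /andP[] := q0 x.
have fE x r : (q x < r%:E)%E = (fine (q x) < r) by rewrite -{1}(fineK (qf x)).
have fE' x r : (q x <= r%:E)%E = (fine (q x) <= r) by rewrite -{1}(fineK (qf x)).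
have sc l x : fine (q (l *: x)) <= Normc.normc l * fine (q x).
  apply/ler_addgt0Pr => e e0.
  (* The added 1 keeps the denominator below positive when [l] is 0. *)
  have l1 : 0 < Normc.normc l + 1 by rewrite ltr_wpDl ?normc_ge0.
  have := qZ l x (fine (q x) + e / (Normc.normc l + 1)).
  rewrite fE fE' ltrDl divr_gt0 // => /(_ isT) /le_trans; apply.
  rewrite mulrDr lerD2l mulrCA ger_pMr // ler_pdivrMr // mul1r lerDl //.
split => //=.
- move=> l x; apply/eqP; rewrite eq_le sc /=.
  have [->|l0] := eqVneq l 0; first by rewrite Normc.normc0 mul0r.
  have nl : 0 < Normc.normc l.
    by rewrite lt0r normc_ge0 andbT; apply: contraNneq l0 => /Normc.eq0_normc ->.
  (* The reverse inequality is the one just proved, for the scalar [l^-1] and the vector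
     [l *: x]. *)
  have := sc l^-1 (l *: x); rewrite scalerA mulVf // scale1r.
  have -> : Normc.normc l^-1 = (Normc.normc l)^-1.
    apply: (mulfI (lt0r_neq0 nl)); rewrite mulfV ?lt0r_neq0 //.
    by rewrite -Normc.normcM mulfV // Normc.normc1.
  by rewrite ler_pdivlMl.
- move=> x y; apply/ler_addgt0Pr => e e0.
  (* The excess is fixed on the p-th powers, so that the errors of [x] and [y] add up to [e]. *)
  have H z : exists2 r, fine (q z) < r & r `^ p = fine (q z) `^ p + e / 2.
    exists ((fine (q z) `^ p + e / 2) `^ p^-1); last first.
      by rewrite powRVK // addr_ge0 ?powR_ge0 // divr_ge0 // ltW.
    rewrite -[ltLHS](powRKV pN0) //; apply: gt0_ltr_powR; rewrite ?invr_gt0 //.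
    + by rewrite nnegrE powR_ge0.
    + by rewrite nnegrE addr_ge0 ?powR_ge0 // divr_ge0 // ltW.
    + by rewrite ltrDl divr_gt0.
  have [r rx rE] := H x; have [t ty tE] := H y.
  have := qD x y r t; rewrite !fE fE' => /(_ rx ty) h.
  have : fine (q (x + y)) `^ p <= ((r `^ p + t `^ p) `^ p^-1) `^ p.
    by apply: ge0_ler_powR; rewrite ?nnegrE ?powR_ge0 // ltW.
  rewrite powRVK ?addr_ge0 ?powR_ge0 // rE tE => /le_trans; apply.
  by rewrite addrACA -splitr.
- by move=> x /eqP; rewrite -eqe fineK // => /eqP /qE0.
Qed.

End PnormTools.

(** * Besov norms *)

Section BesovNorms.
Context {R : realType}.
Implicit Types (x y : Omega R) (sigma p M N : R) (l : R[i]).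

Lemma besov_norm_inf_coef sigma x j (k : 'I_(2 ^ j)) :
  ((2 `^ (sigma * j%:R) * cabs x k)%:E <= besov_norm_inf sigma x)%E.
Proof.
apply: le_ereal_sup_tmp; exists (ereal_sup (range (fun k : 'I_(2 ^ j) =>
    (2 `^ (sigma * j%:R) * cabs x k)%:E))); first by exists j.
by apply: ereal_sup_ubound; exists k.
Qed.

Lemma besov_norm_infP sigma x M : (besov_norm_inf sigma x <= M%:E)%E <->
  forall j (k : 'I_(2 ^ j)), 2 `^ (sigma * j%:R) * cabs x k <= M.
Proof.
split=> [h j k|h].
  by rewrite -lee_fin; apply: le_trans h; exact: besov_norm_inf_coef.
apply: ge_ereal_sup => _ [j _ <-]; apply: ge_ereal_sup => _ [k _ <-].
by rewrite lee_fin.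
Qed.

Lemma besov_norm_inf_ge0 sigma x : (0 <= besov_norm_inf sigma x)%E.
Proof.
apply: le_trans (besov_norm_inf_coef sigma x (ord0 : 'I_(2 ^ 0))).
by rewrite lee_fin mulr_ge0 ?powR_ge0 ?cabs_ge0.
Qed.

Lemma besov_norm_infZ sigma x l M : (besov_norm_inf sigma x <= M%:E)%E ->
  (besov_norm_inf sigma (l *: x)%R <= (Normc.normc l * M)%:E)%E.
Proof.
move=> /besov_norm_infP h; apply/besov_norm_infP => j k.
by rewrite cabsZ mulrCA ler_wpM2l ?normc_ge0.
Qed.

Lemma besov_norm_infD sigma x y M N : (besov_norm_inf sigma x <= M%:E)%E ->
  (besov_norm_inf sigma y <= N%:E)%E ->
  (besov_norm_inf sigma (x + y)%R <= (M + N)%:E)%E.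
Proof.
move=> /besov_norm_infP hx /besov_norm_infP hy; apply/besov_norm_infP => j k.
apply: le_trans (lerD (hx j k) (hy j k)).
by rewrite -mulrDr ler_wpM2l ?powR_ge0 ?cabsD.
Qed.

Lemma besov_norm_le sigma p x M : (besov_norm sigma p x <= M%:E)%E <->
  forall j, 2 `^ ((sigma - p^-1) * j%:R) *
    (\sum_(k < 2 ^ j) cabs x k `^ p) `^ p^-1 <= M.
Proof.
split=> [h j|h].
  by rewrite -lee_fin; apply: le_trans h; apply: ereal_sup_ubound; exists j.
by apply: ge_ereal_sup => _ [j _ <-]; rewrite lee_fin.
Qed.

Lemma sum_powR_ge0 p x j : 0 <= \sum_(k < 2 ^ j) cabs x k `^ p.
Proof. by apply: sumr_ge0 => k _; exact: powR_ge0. Qed.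

Lemma besov_norm_ge0 sigma p x : (0 <= besov_norm sigma p x)%E.
Proof.
apply: le_ereal_sup_tmp; exists (2 `^ ((sigma - p^-1) * 0%N%:R) *
    (\sum_(k < 2 ^ 0) cabs x k `^ p) `^ p^-1)%:E; first by exists 0%N.
by rewrite lee_fin mulr_ge0 ?powR_ge0.
Qed.

(** Taking p-th powers removes the outer root and leaves a condition additive in the |x_{j,k}|^p. *)
Lemma besov_normP sigma p x M : 0 < p -> 0 <= M ->
  (besov_norm sigma p x <= M%:E)%E <->
  forall j, 2 `^ ((sigma * p - 1) * j%:R) *
    \sum_(k < 2 ^ j) cabs x k `^ p <= M `^ p.
Proof.
move=> p0 M0; have pN0 : p != 0 by rewrite gt_eqF.
have E j : 2 `^ ((sigma * p - 1) * j%:R) * \sum_(k < 2 ^ j) cabs x k `^ p =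
   (2 `^ ((sigma - p^-1) * j%:R) *
    (\sum_(k < 2 ^ j) cabs x k `^ p) `^ p^-1) `^ p.
  rewrite powRM ?powR_ge0 // powRVK ?sum_powR_ge0 // -powRrM; congr (_ `^ _ * _).
  by field.
split=> [/besov_norm_le h j|h].
  by rewrite E; apply: ge0_ler_powR; rewrite ?nnegrE ?mulr_ge0 ?powR_ge0 // ltW.
apply/besov_norm_le => j; have := h j; rewrite E => hj.
move: hj; set u := _ * _; have u0 : 0 <= u by rewrite mulr_ge0 ?powR_ge0.
move=> hj; rewrite -(powRKV pN0 M0) -(powRKV pN0 u0).
by apply: ge0_ler_powR; rewrite ?nnegrE ?powR_ge0 ?invr_ge0 // ltW.
Qed.

Lemma besov_norm_coef sigma p x M j (k : 'I_(2 ^ j)) : 0 < p ->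
  (besov_norm sigma p x <= M%:E)%E ->
  2 `^ ((sigma - p^-1) * j%:R) * cabs x k <= M.
Proof.
move=> p0 /besov_norm_le/(_ j); apply: le_trans.
rewrite ler_wpM2l ?powR_ge0 // -{1}(@powRKV _ p (cabs x k)) ?gt_eqF ?cabs_ge0 //.
apply: ge0_ler_powR; rewrite ?nnegrE ?invr_ge0 ?powR_ge0 ?sum_powR_ge0 ?(ltW p0) //.
by rewrite (bigD1 k) //= lerDl sumr_ge0 // => i _; exact: powR_ge0.
Qed.

Lemma besov_normZ sigma p x l M : 0 < p -> 0 <= M ->
  (besov_norm sigma p x <= M%:E)%E ->
  (besov_norm sigma p (l *: x)%R <= (Normc.normc l * M)%:E)%E.
Proof.
move=> p0 M0 /(besov_normP _ _ p0 M0) h.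
apply/(besov_normP _ _ p0) => [|j]; first by rewrite mulr_ge0 ?normc_ge0.
under eq_bigr do rewrite cabsZ powRM ?normc_ge0 ?cabs_ge0 //.
by rewrite -mulr_sumr mulrCA powRM ?normc_ge0 // ler_wpM2l ?powR_ge0.
Qed.

(** Subadditivity of u^p is applied coefficient by coefficient at each scale. *)
Lemma besov_normD sigma p x y M N : 0 < p <= 1 -> 0 <= M -> 0 <= N ->
  (besov_norm sigma p x <= M%:E)%E -> (besov_norm sigma p y <= N%:E)%E ->
  (besov_norm sigma p (x + y)%R <= ((M `^ p + N `^ p) `^ p^-1)%:E)%E.
Proof.
move=> p01 M0 N0; have [p0 p1] := andP p01.
move=> /(besov_normP _ _ p0 M0) hx /(besov_normP _ _ p0 N0) hy.
apply/(besov_normP _ _ p0) => [|j]; first exact: powR_ge0.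
rewrite powRVK ?gt_eqF ?addr_ge0 ?powR_ge0 //.
apply: le_trans (lerD (hx j) (hy j)).
rewrite -mulrDr ler_wpM2l ?powR_ge0 // -big_split /=; apply: ler_sum => k _.
apply: (@le_trans _ _ ((cabs x k + cabs y k) `^ p)).
  by apply: ge0_ler_powR; rewrite ?nnegrE ?addr_ge0 ?cabs_ge0 ?cabsD // ltW.
by apply: powR_subadditive; rewrite ?cabs_ge0.
Qed.

End BesovNorms.

(** * The interpolation p-norm *)

Section InterpNorm.
Context {R : realType} (nu : R -> \bar R) (p alpha eps : R).
Hypothesis p01 : 0 < p <= 1.
Implicit Types (x y : Omega R) (M N r t : R) (l : R[i]).

Let p0 : 0 < p. Proof. by case/andP: p01. Qed.
Let s := alpha + (1 - fine (nu alpha)) / p - eps.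
Let q := interp_norm nu p alpha eps.

Lemma interp_norm_le x x' x'' M N : x' + x'' = x ->
  (besov_norm s p x' <= M%:E)%E -> (besov_norm_inf alpha x'' <= N%:E)%E ->
  (q x <= (M + N)%:E)%E.
Proof.
move=> xE hM hN; apply: (@le_trans _ _ (besov_norm s p x' + besov_norm_inf alpha x'')%E).
  apply: ereal_inf_lbound; exists x', x''; split => //.
  - exact: le_lt_trans hM (ltry _).
  - exact: le_lt_trans hN (ltry _).
by rewrite EFinD leeD.
Qed.

(** This extracts a nearly optimal splitting, with real numbers in place of the two extended
    norms. *)
Lemma interp_norm_lt x r : (q x < r%:E)%E -> exists x' x'' M N,
  [/\ x' + x'' = x, 0 <= M /\ (besov_norm s p x' <= M%:E)%E,
      0 <= N /\ (besov_norm_inf alpha x'' <= N%:E)%E & M + N < r].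
Proof.
move=> /ereal_inf_lt[_ [x' [x'' [h1 h2 xE ->]]] h].
have f1 : besov_norm s p x' \is a fin_num by rewrite ge0_fin_numE ?besov_norm_ge0.
have f2 : besov_norm_inf alpha x'' \is a fin_num by rewrite ge0_fin_numE ?besov_norm_inf_ge0.
exists x', x'', (fine (besov_norm s p x')), (fine (besov_norm_inf alpha x'')).
rewrite !fineK // !fine_ge0 ?besov_norm_ge0 ?besov_norm_inf_ge0 //; split=> //.
by rewrite -lte_fin EFinD !fineK.
Qed.

Lemma interp_norm_ge0 x : (0 <= q x)%E.
Proof.
apply: le_ereal_inf_tmp => _ [x' [x'' [_ _ _ ->]]].
by rewrite adde_ge0 ?besov_norm_ge0 ?besov_norm_inf_ge0.
Qed.

Lemma interp_normZ l x r : (q x < r%:E -> q (l *: x)%R <= (Normc.normc l * r)%:E)%E.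
Proof.
move=> /interp_norm_lt[x' [x'' [M [N [<- [M0 hM] [N0 hN] MN]]]]].
apply: (@le_trans _ _ (Normc.normc l * M + Normc.normc l * N)%:E).
  by apply: interp_norm_le (besov_normZ _ p0 M0 hM) (besov_norm_infZ _ hN); rewrite scalerDr.
by rewrite lee_fin -mulrDr ler_wpM2l ?normc_ge0 // ltW.
Qed.

(** Nearly optimal splittings are added termwise; the reverse Minkowski inequality then recombines
    the p-norm part with the norm part. *)
Lemma interp_normD x y r t : (q x < r%:E -> q y < t%:E ->
  q (x + y)%R <= ((r `^ p + t `^ p) `^ p^-1)%:E)%E.
Proof.
move=> /interp_norm_lt[x' [x'' [M [N [<- [M0 hM] [N0 hN] MN]]]]].
move=> /interp_norm_lt[y' [y'' [M' [N' [<- [M'0 hM'] [N'0 hN'] MN']]]]].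
apply: le_trans (interp_norm_le _ (besov_normD p01 M0 M'0 hM hM') (besov_norm_infD hN hN')) _.
  by rewrite addrACA.
rewrite lee_fin -[leLHS](@powRKV _ p) ?gt_eqF ?addr_ge0 ?powR_ge0 //.
apply: ge0_ler_powR; rewrite ?nnegrE ?invr_ge0 ?addr_ge0 ?powR_ge0 ?(ltW p0) //.
apply: le_trans (powR_reverse_minkowski p01 M0 N0 M'0 N'0) _.
by apply: lerD; apply: ge0_ler_powR; rewrite ?nnegrE ?addr_ge0 ?(ltW p0) ?(ltW MN) ?(ltW MN') //;
  apply: le_trans (ltW MN) || apply: le_trans (ltW MN'); rewrite addr_ge0.
Qed.

(** Multiplied by the smaller of the two weights at scale [j], a coefficient is at most the cost of
    any splitting, and this cost can be made arbitrarily small. *)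
Lemma interp_norm_eq0 x : q x = 0%E -> x = 0.
Proof.
move=> qx; apply: cabs_eq0 => j k; apply/eqP; rewrite eq_le cabs_ge0 andbT.
pose w := Num.min (2 `^ ((s - p^-1) * j%:R)) (2 `^ (alpha * j%:R)) : R.
have w0 : 0 < w by rewrite lt_min !powR_gt0.
rewrite -(pmulr_rle0 _ w0); apply/ler_addgt0Pr => r r0; rewrite add0r.
have : (q x < r%:E)%E by rewrite qx lte_fin.
move=> /interp_norm_lt[x' [x'' [M [N [<- [M0 hM] [N0 hN] MN]]]]].
apply: le_trans (ltW MN).
apply: le_trans (lerD (besov_norm_coef k p0 hM) ((besov_norm_infP _ _ _).1 hN j k)).
apply: (@le_trans _ _ (w * cabs x' k + w * cabs x'' k)).
  by rewrite -mulrDr ler_wpM2l ?cabsD // ltW.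
by apply: lerD; rewrite ler_wpM2r ?cabs_ge0 // /w ge_min lexx ?orbT.
Qed.

End InterpNorm.

(** * Growth of an admissible profile *)

Section ProfileTheory.
Context {R : realType} (nu : admissible_profile R).
Implicit Types (a b c r : R).

Lemma profile_right_lt a r : (nu a < r%:E)%E ->
  exists2 d : R, 0 < d & (nu (a + d)%R < r%:E)%E.
Proof.
move=> ar.
have : \forall y \near nu a, (y < r%:E)%E.
  by apply: open_nbhs_nbhs; split => //; exact: open_ereal_lt_ereal.
move=> /(@profile_right_continuous R nu a) /= [d /= d0 h].
exists (d / 2); first by rewrite divr_gt0.
apply: h; last by rewrite /= ltrDl divr_gt0.
by rewrite /ball_ /= opprD addNKr normrN gtr0_norm ?divr_gt0 // ltr_pdivrMr // ltr_pMr // ltr1n.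
Qed.

Lemma profile_lt_min a : (a%:E < alpha_min nu)%E -> nu a = -oo%E.
Proof.
move=> am; case: (profile_range nu a) => // /andP[nu0 _].
suff /(lt_le_trans am) : (alpha_min nu <= a%:E)%E by rewrite ltxx.
by apply: ereal_inf_lbound; exists a.
Qed.

(** If [nu a] were -oo, right continuity would keep [nu] negative up to some [a + d], whereas the
    infimum provides a point below [a + d] with a nonnegative value. *)
Lemma profile_ge_min a : (alpha_min nu <= a%:E)%E -> (0 <= nu a <= 1)%E.
Proof.
move=> am; case: (profile_range nu a) => // nua.
have [d d0] : exists2 d : R, 0 < d & (nu (a + d)%R < 0%:E)%E.
  by apply: profile_right_lt; rewrite nua ltNyr.
have : (alpha_min nu < (a + d)%:E)%E.
  by apply: le_lt_trans am _; rewrite lte_fin ltrDl.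
move=> /ereal_inf_lt[_ [b /= nub <-]]; rewrite lte_fin => bad.
move=> /lt_geF/negbT/negP[]; apply: le_trans nub _.
exact/profile_nondecreasing/ltW.
Qed.

(** The argument is the same with the value 1; right continuity is what includes the endpoint
    [alpha_max] itself. *)
Lemma profile_ge_max a : (alpha_max nu <= a%:E)%E -> nu a = 1%E.
Proof.
move=> am; apply/eqP; rewrite eq_le; apply/andP; split.
  by case: (profile_range nu a) => [->|/andP[] //]; rewrite leNye.
rewrite leNgt; apply/negP => /profile_right_lt[d d0].
have : (alpha_max nu < (a + d)%:E)%E.
  by apply: le_lt_trans am _; rewrite lte_fin ltrDl.
move=> /ereal_inf_lt[_ [b /= nub <-]]; rewrite lte_fin => bad.
move=> /lt_geF/negbT/negP[]; rewrite -[leLHS]nub.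
exact/profile_nondecreasing/ltW.
Qed.

Lemma profile_fineK a : (alpha_min nu <= a%:E)%E -> (fine (nu a))%:E = nu a.
Proof.
move=> /profile_ge_min /andP[n0 n1]; rewrite fineK // fin_numE.
by apply/andP; split; [apply: contraTneq n0 => ->|apply: contraTneq n1 => ->].
Qed.

Hypothesis p_gt0 : (0 < p_zero nu)%E.

Let p := fine (p_zero nu).

Lemma p_zeroE : p%:E = p_zero nu.
Proof.
rewrite fineK // ge0_fin_numE ?ltW //; apply: (@le_lt_trans _ _ 1%E) => //.
  by rewrite ge_min lexx.
by rewrite ltry.
Qed.

Lemma p_zero_bounds : 0 < p <= 1.
Proof. by rewrite -!lte_fin -lee_fin p_zeroE p_gt0 ge_min lexx. Qed.

(** The lower bound [p] on the right-inf derivative integrates to a growth bound even where [nu] is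
    discontinuous: the set of points reached with a given smaller slope has a supremum, and this
    supremum cannot lie before [a]. *)
Lemma profile_slope b a : (alpha_min nu <= b%:E)%E -> b <= a ->
  (a%:E < alpha_max nu)%E -> fine (nu b) + p * (a - b) <= fine (nu a).
Proof.
move=> mb ba aM.
have m t : b <= t -> (alpha_min nu <= t%:E)%E.
  by move=> bt; apply: le_trans mb _; rewrite lee_fin.
have mono t u : b <= t -> t <= u -> fine (nu t) <= fine (nu u).
  move=> bt tu; rewrite -lee_fin !profile_fineK ?m ?(le_trans bt) //.
  exact: profile_nondecreasing.
(* A slope below [p] is exceeded strictly by the derivative; afterwards [c] tends to [p]. *)
suff H c : c < p -> fine (nu b) + c * (a - b) <= fine (nu a).
  apply/ler_addgt0Pr => e e0.
  have ab1 : 0 < a - b + 1 by rewrite ltr_wpDl // subr_ge0.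
  have := H (p - e / (a - b + 1)); rewrite gtrBl divr_gt0 // => /(_ isT).
  rewrite mulrBl addrA lerBlDr => /le_trans; apply; rewrite lerD2l.
  by rewrite mulrAC ler_pdivrMr // ler_wpM2l ?(ltW e0) // lerDl.
move=> cp.
(* nu may jump at sup A, but only upwards, so monotonicity puts sup A in A. *)
pose A := [set t | b <= t <= a /\ fine (nu b) + c * (t - b) <= fine (nu t)].
have Ab : A b by rewrite /A /= lexx ba subrr mulr0 addr0.
have supA : has_sup A by split; [exists b|exists a => t [/andP[]]].
have bT : b <= sup A by apply: ub_le_sup => //; exact: supA.2.
have Ta : sup A <= a by apply: ge_sup; [exists b|move=> t [/andP[]]].
have AT : fine (nu b) + c * (sup A - b) <= fine (nu (sup A)).
  apply/ler_addgt0Pr => e e0.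
  have c1 : 0 < `|c| + 1 by rewrite ltr_wpDl.
  have [t At tT] := sup_adherent (divr_gt0 e0 c1) supA.
  have [/andP[bt ta] h] := At.
  have tS : t <= sup A by apply: ub_le_sup => //; exact: supA.2.
  apply: (@le_trans _ _ (fine (nu t) + e)); last by rewrite lerD2r mono.
  rewrite -(lerD2r e) in h; apply: le_trans h.
  have -> : sup A - b = (t - b) + (sup A - t) by ring.
  rewrite mulrDr addrA lerD2l.
  apply: le_trans (ler_norm _) _; rewrite normrM (ger0_norm (_ : 0 <= sup A - t)) ?subr_ge0 //.
  apply: (@le_trans _ _ ((`|c| + 1) * (e / (`|c| + 1)))); last first.
    by rewrite mulrC divfK ?gt_eqF.
  apply: ler_pM; rewrite ?subr_ge0 ?lerDl //.
  by rewrite lerBlDr -lerBlDl ltW.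
move: Ta; rewrite le_eqVlt => /predU1P[<- //|Ta].
(* If [sup A < a], some step [h] to the right stays in [A], contradicting the supremum. *)
have : (c%:E < right_inf_derivative nu (sup A))%E.
  apply: (@lt_le_trans _ _ p%:E); first by rewrite lte_fin.
  rewrite p_zeroE ge_min; apply/orP; right; apply: ereal_inf_lbound.
  exists (sup A) => //; split; first exact: m.
  by apply: lt_trans aM; rewrite lte_fin.
rewrite /right_inf_derivative limf_einfE.
move=> /ereal_sup_gt[_ [V [d /= d0 dV] <-] cV].
(* The first bound keeps [h] where the difference quotient exceeds [c], the second keeps [sup A + h]
   at most [a]. *)
pose h := Num.min (d / 2) (a - sup A).
have h0 : 0 < h by rewrite lt_min divr_gt0 //= subr_gt0.
have hd : h < d.
  by rewrite gt_min ltr_pdivrMr // ltr_pMr // ltr1n.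
have ha : h <= a - sup A by rewrite ge_min lexx orbT.
have Vh : V h by apply: dV => //=; rewrite sub0r normrN gtr0_norm.
have bh : b <= sup A + h by apply: le_trans bT _; rewrite lerDl ltW.
have : A (sup A + h).
  split; first by rewrite bh -lerBrDl.
  have : (c%:E < (nu (sup A + h)%R - nu (sup A)) * (h^-1)%:E)%E.
    by apply: lt_le_trans cV _; apply: ereal_inf_lbound; exists h.
  rewrite -(profile_fineK (m _ bh)) -(profile_fineK (m _ bT)) -EFinB -EFinM lte_fin.
  rewrite ltr_pdivlMr // => cH.
  have -> : sup A + h - b = (sup A - b) + h by ring.
  rewrite mulrDr addrA; apply: le_trans (lerD AT (ltW cH)) _.
  by rewrite addrC subrK.
move=> /(ub_le_sup supA.2); rewrite gerDl leNgt h0 //.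
Qed.

End ProfileTheory.

(** * Splitting a sequence along finitely many levels *)

Section LevelDecomposition.
Context {R : realType} (nu : R -> \bar R) (p alpha eps : R).
Hypothesis p01 : 0 < p <= 1.

(** In the count hypothesis the term [p * b i] cancels the size of the coefficients between levels
    [i] and [i.+1], so that each of the [L] layers contributes at most C^(1+p) 2^(gamma j) to the
    sum of p-th powers. The last hypothesis says that the Besov weight compensates 2^(gamma j) at
    every scale. *)
Lemma interp_norm_le_levels (x : Omega R) (C gamma : R) (L : nat) (b : nat -> R) :
  0 < C ->
  (forall j (k : 'I_(2 ^ j)), cabs x k < C * 2 `^ (- b 0%N * j%:R)) ->
  (forall i j, (i < L)%N ->
     (count_ge x j (C * 2 `^ (- b i.+1 * j%:R)))%:R
       <= C * 2 `^ ((gamma + p * b i) * j%:R)) ->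
  alpha <= b L ->
  (alpha + (1 - fine (nu alpha)) / p - eps) * p - 1 + gamma <= 0 ->
  (interp_norm nu p alpha eps x
     <= ((L%:R * C `^ (1 + p)) `^ p^-1 + C)%:E)%E.
Proof.
move=> C0 x0 xi aL sg; have [p0 p1] := andP p01; have pN0 : p != 0 by rewrite gt_eqF.
pose T i j : R := C * 2 `^ (- b i * j%:R).
have T0 i j : 0 < T i j by rewrite mulr_gt0 ?powR_gt0.
pose x' : Omega R := fun z => if T L (projT1 z) <= Normc.normc (x z) then x z else 0.
have x'E j (k : 'I_(2 ^ j)) :
    cabs x' k = if T L j <= cabs x k then cabs x k else 0.
  by rewrite /cabs /x' /=; case: ifP => // _; rewrite Normc.normc0.
have x''E j (k : 'I_(2 ^ j)) : cabs (x - x') k <= T L j.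
  have -> : cabs (x - x') k = if T L j <= cabs x k then 0 else cabs x k.
    rewrite /cabs /= -[(x - x') _]/(x (existT _ j k) - x' (existT _ j k)) /x' /=.
    by case: ifP => _; rewrite ?subrr ?Normc.normc0 ?subr0.
  by case: ifP => [_|/negbT]; [exact: ltW|rewrite -ltNge => /ltW].
apply: (@interp_norm_le _ nu p alpha eps x x' (x - x')).
- by rewrite addrC subrK.
- apply/(besov_normP _ _ p0) => [|j]; first exact: powR_ge0.
  rewrite powRVK ?mulr_ge0 ?powR_ge0 //.
  (* Each coefficient of [x'] is charged to a layer: it reaches level [i.+1] but not level [i],
     hence is below [T i j]. *)
  have pt (k : 'I_(2 ^ j)) :
      cabs x' k `^ p <= \sum_(i < L) T i j `^ p * (T i.+1 j <= cabs x k)%R%:R.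
    have S0 : 0 <= \sum_(i < L) T i j `^ p * (T i.+1 j <= cabs x k)%R%:R.
      by apply: sumr_ge0 => i _; rewrite mulr_ge0 ?powR_ge0.
    rewrite x'E; case: ifP => [TL|_]; last by rewrite powR0.
    have ex : exists i, T i j <= cabs x k by exists L.
    (* Taking the least such i avoids assuming that the levels are sorted. *)
    have := ex_minnP ex; case=> -[|i] Ti imin.
      by have := lt_le_trans (x0 j k) Ti; rewrite ltxx.
    have iL : (i < L)%N by exact: imin.
    rewrite (bigD1 (Ordinal iL)) //; apply: ler_wpDr.
      by apply: sumr_ge0 => ? _; rewrite mulr_ge0 ?powR_ge0.
    have {}Ti : T (Ordinal iL).+1 j <= cabs x k by exact: Ti.
    rewrite Ti mulr1.
    apply: ge0_ler_powR; rewrite ?nnegrE ?cabs_ge0 ?(ltW p0) ?(ltW (T0 _ _)) //.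
    rewrite leNgt; apply/negP => /ltW/imin; by rewrite ltnn.
  apply: (@le_trans _ _ (2 `^ (((alpha + (1 - fine (nu alpha)) / p - eps) * p - 1) * j%:R) *
      (L%:R * (C `^ (1 + p) * 2 `^ (gamma * j%:R))))).
    rewrite ler_wpM2l ?powR_ge0 //; apply: le_trans (ler_sum _ (fun k _ => pt k)) _.
    rewrite exchange_big /= -[L in leRHS]card_ord -sum1_card natr_sum mulr_suml.
    apply: ler_sum => i _; rewrite mul1r -mulr_sumr.
    have -> : \sum_(k < 2 ^ j) (T i.+1 j <= cabs x k)%R%:R = (count_ge x j (T i.+1 j))%:R :> R.
      by rewrite -natr_sum /count_ge -sum1_card [in RHS]big_mkcond.
    apply: (@le_trans _ _ (T i j `^ p * (C * 2 `^ ((gamma + p * b i) * j%:R)))).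
      by rewrite ler_wpM2l ?powR_ge0 // xi.
    rewrite /T powRM ?(ltW C0) ?powR_ge0 // -powRrM.
    rewrite (@powRD _ C) ?(gt_eqF C0) ?implybT // powRr1 ?(ltW C0) //.
    rewrite [X in X <= _](_ : _ = C * C `^ p *
      (2 `^ (- b i * j%:R * p) * 2 `^ ((gamma + p * b i) * j%:R))); last by ring.
    rewrite -powRD ?pnatr_eq0 ?implybT //.
    by rewrite [X in 2 `^ X](_ : _ = gamma * j%:R) //; ring.
  rewrite [X in X <= _](_ : _ = L%:R * C `^ (1 + p) *
     2 `^ (((alpha + (1 - fine (nu alpha)) / p - eps) * p - 1 + gamma) * j%:R)).
    rewrite ler_piMr ?mulr_ge0 ?powR_ge0 //.
    rewrite -[leRHS](@powRr0 _ 2); rewrite ler_powR ?ler1n //.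
    by rewrite mulr_le0_ge0.
  by rewrite (mulrDl _ gamma) (@powRD _ 2) ?pnatr_eq0 ?implybT //; ring.
- apply/besov_norm_infP => j k.
  apply: (@le_trans _ _ (2 `^ (alpha * j%:R) * T L j)); first by rewrite ler_wpM2l ?powR_ge0.
  rewrite /T mulrCA ler_piMr ?(ltW C0) // -powRD ?pnatr_eq0 ?implybT //.
  rewrite -[leRHS](@powRr0 _ 2); rewrite ler_powR ?ler1n //.
  by rewrite -mulrDl mulr_le0_ge0 // subr_le0.
Qed.

End LevelDecomposition.

Section ProfileLevels.
Context {R : realType} (nu : admissible_profile R).
Hypothesis p_gt0 : (0 < p_zero nu)%E.
Hypothesis min_fin : alpha_min nu \is a fin_num.

Let p := fine (p_zero nu).

(** Three ranges of [t] are merged into one affine exponent: below [alpha_min] the left side is 0,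
    from there to [alpha] the slope bound applies, and beyond [alpha] the profile has grown by at
    most [eta]. *)
Lemma exp2_profile_le (alpha d eta t e : R) j : alpha_range nu alpha ->
  (nu (alpha + d)%R <= (fine (nu alpha) + eta)%:E)%E -> 0 <= eta ->
  t <= alpha + d ->
  exp2 (nu t + e%:E)%E j
    <= 2 `^ ((fine (nu alpha) - p * (alpha - t) + eta + e) * j%:R).
Proof.
move=> [am aM] nud eta0 td; have [p0 p1] := andP (p_zero_bounds p_gt0).
have [tm|mt] := ltP t%:E (alpha_min nu).
  by rewrite profile_lt_min //= powR_ge0.
rewrite -(profile_fineK mt) /= ler_powR ?ler1n // ler_wpM2r // lerD2r.
have [ta|at_] := leP t alpha.
  by have := profile_slope p_gt0 mt ta aM; rewrite -/p; lra.
have : fine (nu t) <= fine (nu alpha) + eta.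
  rewrite -lee_fin profile_fineK //; apply: le_trans nud.
  exact: profile_nondecreasing.
have : 0 <= p * (t - alpha) by rewrite mulr_ge0 ?subr_ge0 ?(ltW p0) // ltW.
rewrite mulrBr (mulrBr p alpha); lra.
Qed.

(** The levels are taken from an order-dense set [D], to be either the whole line or the range of
    the sequence defining the topology. They depend on neither [x] nor [C], so the bound gives
    continuity as well as finiteness. *)
Lemma interp_norm_le_admissible (D : set R) (alpha eps : R) :
  (forall u v : R, u < v -> exists2 t, D t & u < t < v) ->
  alpha_range nu alpha -> 0 < eps ->
  exists (L : nat) (b : nat -> R) (e0 : R), [/\ 0 < e0, forall i, D (b i) &
    forall (e C : R) (x : Omega R), 0 < e <= e0 -> 0 < C ->
      (forall i, (i <= L)%N -> dist_admissible (b i) (nu (b i) + e%:E)%E x C) ->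
      (interp_norm nu p alpha eps x
        <= ((L%:R * C `^ (1 + p)) `^ p^-1 + C)%:E)%E].
Proof.
move=> dD ar eps0; have [am aM] := ar.
have p01 := p_zero_bounds p_gt0; have [p0 p1] := andP p01; rewrite -/p in p0 p1 p01.
(* The budget is [p * eps]: a quarter for the growth of [nu] just after [alpha], a quarter for [e],
   and half for the gaps between levels, which are less than [2 * dl]. *)
pose eta := p * eps / 4; have eta0 : 0 < eta by rewrite divr_gt0 ?mulr_gt0.
have [d d0 nud] : exists2 d : R, 0 < d & (nu (alpha + d)%R < (fine (nu alpha) + eta)%:E)%E.
  by apply: profile_right_lt; rewrite -[ltLHS]profile_fineK // lte_fin ltrDl.
pose dl := Num.min d (eps / 4); have dl0 : 0 < dl by rewrite lt_min d0 divr_gt0.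
have dld : dl <= d by rewrite ge_min lexx.
have dle : dl <= eps / 4 by rewrite ge_min lexx orbT.
pose m := fine (alpha_min nu); have mE : alpha_min nu = m%:E by rewrite fineK.
have ma : m <= alpha by rewrite -lee_fin -mE.
(* The extra step puts [g 1] at or below [m], hence [b 0] strictly below [alpha_min], where no
   coefficient may reach the threshold. *)
pose L := (Num.bound ((alpha - m) / dl)).+1.
have hL : alpha - m <= L.-1%:R * dl.
  by rewrite -ler_pdivrMr // ltW // archi_boundP // divr_ge0 ?subr_ge0 // ltW.
pose g (i : nat) : R := alpha - L%:R * dl + i%:R * dl.
have gS i : g i.+1 = g i + dl by rewrite /g -natr1; ring.
have /choice[b hb] : forall i, exists t, D t /\ g i < t < g i.+1.
  move=> i; have [t Dt tg] : exists2 t, D t & g i < t < g i.+1.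
    by apply: dD; rewrite gS ltrDl.
  by exists t.
have gL : g L = alpha by rewrite /g subrK.
exists L, b, eta; split=> // [i|e C x /andP[e0 eeta] C0 adm]; first by case: (hb i).
pose gamma := fine (nu alpha) - p * alpha + eta + eta + 2 * p * dl.
apply: (@interp_norm_le_levels _ nu p alpha eps p01 x C gamma L b) => //.
- move=> j k.
  have b0 : ((b 0%N)%:E < alpha_min nu)%E.
    rewrite mE lte_fin; case: (hb 0%N) => _ /andP[_ /lt_le_trans]; apply.
    move: hL; rewrite /g /L /= -natr1; lra.
  have [_ /(_ j)] := adm 0%N (leq0n _); rewrite profile_lt_min //= mulr0.
  rewrite ltNge => cnt; apply/negP => /count_ge_gt0; rewrite -(ltr_nat R).
  by rewrite ltNge cnt.
- move=> i j iL; have [_ /(_ j)] := adm i.+1 iL; move=> /le_trans; apply.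
  rewrite ler_wpM2l ?(ltW C0) //.
  have [_ /andP[h1 h2]] := hb i; have [_ /andP[h3 h4]] := hb i.+1.
  have gi : g i.+2 <= alpha + dl.
    rewrite gS lerD2r -gL /g lerD2l ler_wpM2r ?(ltW dl0) // ler_nat //.
  apply: le_trans (@exp2_profile_le alpha d eta (b i.+1) e j ar (ltW nud) (ltW eta0) _) _.
    by rewrite ltW // (lt_le_trans h4) // (le_trans gi) // lerD2l.
  rewrite ler_powR ?ler1n // ler_wpM2r //.
  have : p * (b i.+1 - b i) <= p * (2 * dl).
    rewrite ler_wpM2l ?(ltW p0) //; move: h1 h4; rewrite !gS; lra.
  rewrite /gamma mulrBr (mulrBr p alpha); lra.
- by have [_ /andP[]] := hb L; rewrite gL => /ltW.
- have -> : (alpha + (1 - fine (nu alpha)) / p - eps) * p - 1 + gamma =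
    - (p * eps) + eta + eta + 2 * p * dl.
    by rewrite /gamma; field; rewrite gt_eqF.
  have : p * dl <= p * (eps / 4) by rewrite ler_wpM2l // ltW.
  rewrite /eta; lra.
Qed.

End ProfileLevels.

(** * From norm bounds to coefficient counts *)

Section BesovAdmissible.
Context {R : realType}.
Implicit Types (x : Omega R) (a s t M C : R).

Lemma besov_norm_inf_lt s x M j (k : 'I_(2 ^ j)) :
  (besov_norm_inf s x < M%:E)%E -> 2 `^ (s * j%:R) * cabs x k < M.
Proof. by rewrite -lte_fin; exact/le_lt_trans/besov_norm_inf_coef. Qed.

Lemma besov_norm_inf_le s t x : s <= t ->
  (besov_norm_inf s x <= besov_norm_inf t x)%E.
Proof.
move=> st; apply: ge_ereal_sup => _ [j _ <-]; apply: ge_ereal_sup => _ [k _ <-].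
apply: le_trans (besov_norm_inf_coef t x k).
by rewrite lee_fin ler_wpM2r ?cabs_ge0 // ler_powR ?ler1n // ler_wpM2r.
Qed.

(** For exponent -oo every count must vanish, which is a uniform bound on the weighted
    coefficients. *)
Lemma dist_admissible_ninfty a x C :
  dist_admissible a -oo%E x C -> (besov_norm_inf a x <= C%:E)%E.
Proof.
move=> [_ adm]; apply/besov_norm_infP => j k.
have := adm j; rewrite /= mulr0 => cnt.
have : cabs x k < C * 2 `^ (- a * j%:R).
  rewrite ltNge; apply/negP => /count_ge_gt0; rewrite -(ltr_nat R).
  by rewrite ltNge cnt.
by rewrite mulNr powRN ltr_pdivlMr ?powR_gt0 // mulrC => /ltW.
Qed.

Lemma besov_dist_admissible_ninfty a s x C : 0 <= C -> a <= s ->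
  (besov_norm_inf s x < C%:E)%E -> dist_admissible a -oo%E x C.
Proof.
move=> C0 as_ h; split => // j; rewrite /= mulr0 count_ge_eq0 // => k.
rewrite mulNr powRN ltr_pdivlMr ?powR_gt0 // mulrC.
by apply: besov_norm_inf_lt; apply: le_lt_trans (besov_norm_inf_le _ as_) h.
Qed.

(* The count never exceeds 2 ^ j, so only finitely many scales matter. *)
Lemma besov_dist_admissible_1 a s e C : 0 < e -> 0 < C ->
  exists2 eta : R, 0 < eta & forall x, (besov_norm_inf s x < eta%:E)%E ->
    dist_admissible a (1 + e%:E)%E x C.
Proof.
move=> e0 C0; have [J _ hJ] := near_powM2 C^-1 e0.
(* Below scale [J] the weights with exponents [a] and [s] differ by a factor of at most 2^u, so a
   small norm makes the counts vanish. From [J] on, the trivial count 2^j is below the allowed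
   one. *)
pose u := `|a - s| * J%:R.
exists (C * 2 `^ (- u)); first by rewrite mulr_gt0 ?powR_gt0.
move=> x hx; split=> [|j]; first exact: ltW.
have [jJ|Jj] := ltnP j J.
  rewrite count_ge_eq0 ?mulr_ge0 ?exp2_ge0 ?(ltW C0) // => k.
  rewrite mulNr powRN ltr_pdivlMr ?powR_gt0 // mulrC.
  have -> : 2 `^ (a * j%:R) = 2 `^ ((a - s) * j%:R) * 2 `^ (s * j%:R).
    rewrite -powRD ?pnatr_eq0 ?implybT //; congr (_ `^ _); ring.
  rewrite -mulrA; apply: (@lt_le_trans _ _ (2 `^ ((a - s) * j%:R) * (C * 2 `^ (- u)))).
    by rewrite ltr_pM2l ?powR_gt0 //; exact: besov_norm_inf_lt.
  rewrite mulrCA ler_piMr ?(ltW C0) // -powRD ?pnatr_eq0 ?implybT //.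
  rewrite -[leRHS](@powRr0 _ 2) ler_powR ?ler1n // subr_le0 /u.
  apply: (@le_trans _ _ (`|a - s| * j%:R)); first by rewrite ler_wpM2r // ler_norm.
  by rewrite ler_wpM2l // ler_nat ltnW.
apply: (@le_trans _ _ (2 `^ (1 * j%:R))).
  rewrite mul1r powR_mulrn // -natrX ler_nat.
  by apply: leq_trans (max_card _) _; rewrite card_ord.
rewrite /= mulrDl powRD ?pnatr_eq0 ?implybT // mulrCA ler_peMr ?powR_ge0 //.
by rewrite -ler_pdivrMl // mulr1; exact: hJ.
Qed.

Lemma count_ge_markov p x j t : 0 <= p -> 0 <= t ->
  (count_ge x j t)%:R * t `^ p <= \sum_(k < 2 ^ j) cabs x k `^ p.
Proof.
move=> p0 t0; rewrite /count_ge -sum1_card natr_sum mulr_suml big_mkcond /=.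
apply: ler_sum => k _; rewrite inE; case: ifPn => [tk|_]; last exact: powR_ge0.
by rewrite mul1r ge0_ler_powR ?nnegrE ?cabs_ge0.
Qed.

(** Since [a <= alpha], the part [x''] stays below half the threshold, so a large coefficient of [x]
    forces one of [x'] above the other half. These are counted by Markov's inequality. *)
Lemma interp_dist_admissible (nu : R -> \bar R) (p alpha eps a b C : R) :
  0 < p -> 0 < C -> a <= alpha -> fine (nu alpha) + p * (a - alpha) + p * eps <= b ->
  exists2 eta : R, 0 < eta & forall x,
    (interp_norm nu p alpha eps x < eta%:E)%E -> dist_admissible a b%:E x C.
Proof.
move=> p0 C0 aal hb; have C20 : 0 < C / 2 by rewrite divr_gt0.
pose mn := Num.min 1 (C `^ p^-1).
have mn0 : 0 < mn by rewrite lt_min ltr01 powR_gt0.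
have mn1 : mn <= 1 by rewrite ge_min lexx.
have mnp : mn `^ p <= C.
  rewrite -[leRHS](@powRVK _ p) ?gt_eqF ?(ltW C0) //.
  apply: ge0_ler_powR; rewrite ?nnegrE ?(ltW p0) ?(ltW mn0) ?powR_ge0 //.
  by rewrite ge_min lexx orbT.
exists (C / 2 * mn); first exact: mulr_gt0.
move=> x /interp_norm_lt[x' [x'' [M [N [xE [M0 hM] [N0 hN] MN]]]]].
split=> [|j /=]; first exact: ltW.
pose w : R := 2 `^ (- a * j%:R); have w0 : 0 < w by rewrite powR_gt0.
have x''w (k : 'I_(2 ^ j)) : cabs x'' k < C / 2 * w.
  rewrite /w mulNr powRN ltr_pdivlMr ?powR_gt0 // mulrC.
  apply: (@le_lt_trans _ _ N).
    apply: le_trans ((besov_norm_infP _ _ _).1 hN j k).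
    by rewrite ler_wpM2r ?cabs_ge0 // ler_powR ?ler1n // ler_wpM2r.
  apply: (@lt_le_trans _ _ (C / 2 * mn)); last by rewrite ler_piMr ?(ltW C20).
  by apply: le_lt_trans MN; rewrite lerDr.
apply: (@le_trans _ _ (count_ge x' j (C / 2 * w))%:R).
  rewrite ler_nat; apply: count_ge_sub => k; rewrite -xE -/w => xk.
  have := cabsD x' x'' k; have := x''w k.
  have Cw : C * w = C / 2 * w + C / 2 * w by rewrite -mulrDl -splitr.
  move: xk; rewrite Cw.
  move: (C / 2 * w) (cabs (x' + x'') k) (cabs x' k) (cabs x'' k) => *; lra.
pose s := alpha + (1 - fine (nu alpha)) / p - eps.
have := (besov_normP _ _ p0 M0).1 hM j; rewrite -/s.
set K := 2 `^ _ => hK; have K0 : 0 < K by rewrite powR_gt0.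
have t0 : 0 < C / 2 * w by exact: mulr_gt0.
have tp0 : 0 < (C / 2 * w) `^ p by exact: powR_gt0.
rewrite -(ler_pM2r tp0) -(ler_pM2l K0).
apply: le_trans (ler_wpM2l (ltW K0) (count_ge_markov x' j (ltW p0) (ltW t0))) _.
apply: le_trans hK _; apply: (@le_trans _ _ ((C / 2 * mn) `^ p)).
  apply: ge0_ler_powR; rewrite ?nnegrE ?(ltW p0) ?(ltW (mulr_gt0 C20 mn0)) //.
  by apply: le_trans _ (ltW MN); rewrite lerDl.
rewrite powRM ?(ltW C20) ?(ltW mn0) // [X in _ <= _ * (_ * X)]powRM ?(ltW C20) ?(ltW w0) //.
apply: (@le_trans _ _ ((C / 2) `^ p * C)); first by rewrite ler_wpM2l ?powR_ge0.
rewrite [leRHS](_ : _ = (C / 2) `^ p * C * (K * (2 `^ (b * j%:R) * w `^ p))); last by ring.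
rewrite ler_peMr ?mulr_ge0 ?powR_ge0 ?(ltW C0) //.
rewrite /K /w -powRrM -!powRD ?pnatr_eq0 ?implybT //.
rewrite -[leLHS](@powRr0 _ 2) ler_powR ?ler1n //.
(* The exponents combine to the slack in the hypothesis on [b]. *)
rewrite [leRHS](_ : _ = (b - (fine (nu alpha) + p * (a - alpha) + p * eps)) * j%:R).
  by rewrite mulr_ge0 // subr_ge0.
by rewrite /s; field; rewrite gt_eqF.
Qed.

End BesovAdmissible.

(** * Comparison of the two topologies *)

Section NormFamilies.
Context {R : realType} (nu : admissible_profile R).
Hypothesis min_fin : alpha_min nu \is a fin_num.
Hypothesis p_gt0 : (0 < p_zero nu)%E.

Let m := fine (alpha_min nu).
Let p := fine (p_zero nu).

Lemma profile_below_min (a : R) : a < m -> nu a = -oo%E.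
Proof. by move=> am; apply: profile_lt_min; rewrite -(fineK min_fin) lte_fin. Qed.

(** Below [alpha_min] the profile is -oo, so membership in the corresponding space E is finiteness
    of this norm. *)
Lemma S_besov_norm_inf_fin (eps : R) (x : S_space nu) : 0 < eps ->
  (S_besov_norm_inf nu eps x < +oo)%E.
Proof.
move=> e0; have ltm : m - eps < m by rewrite ltrBlDr ltrDl.
have := S_set_subset_E (m - eps) (@ltr01 R) (set_mem (valP x)).
rewrite profile_below_min // => /E_setP[C] /dist_admissible_ninfty h.
exact: le_lt_trans h (ltry _).
Qed.

Lemma S_besov_norm_inf_pnorm (eps : R) : 0 < eps ->
  is_pnorm 1 (fine \o S_besov_norm_inf nu eps).
Proof.
move=> e0; apply: gauge_pnorm; first by rewrite ltr01 lexx.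
- by move=> x; rewrite S_besov_norm_inf_fin // andbT besov_norm_inf_ge0.
- by move=> l x r /ltW; exact: besov_norm_infZ.
- move=> x y r t xr yt.
  have r0 : 0 <= r by rewrite -lee_fin (le_trans _ (ltW xr)) // besov_norm_inf_ge0.
  have t0 : 0 <= t by rewrite -lee_fin (le_trans _ (ltW yt)) // besov_norm_inf_ge0.
  rewrite invr1 !powRr1 ?addr_ge0 //; exact: besov_norm_infD (ltW xr) (ltW yt).
- move=> x x0; apply: val_inj; apply: cabs_eq0 => j k; apply/eqP.
  rewrite eq_le cabs_ge0 andbT -(pmulr_rle0 _ (powR_gt0 ((m - eps) * j%:R) (ltr0Sn R 1))).
  have : (S_besov_norm_inf nu eps x <= 0%:E)%E by rewrite x0.
  by move/besov_norm_infP; exact.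
Qed.

Lemma S_interp_norm_fin (alpha eps : R) (x : S_space nu) :
  alpha_range nu alpha -> 0 < eps -> (S_interp_norm nu alpha eps x < +oo)%E.
Proof.
move=> ar e0.
have [u v uv|L [b [e1 [e10 _ h]]]] :=
  interp_norm_le_admissible p_gt0 min_fin (D := setT) _ ar e0.
  by exists ((u + v) / 2) => //; rewrite !midf_lt.
have /choice[C hC] : forall i, exists C,
    dist_admissible (b i) (nu (b i) + e1%:E)%E (val x) C.
  by move=> i; apply/E_setP; exact: S_set_subset_E e10 _ (set_mem (valP x)).
have C0 i : 0 <= C i by case: (hC i).
(* One constant has to serve all levels; the 1 makes it positive. *)
pose K := 1 + \sum_(i < L.+1) C i.
have K0 : 0 < K by rewrite ltr_pwDl // sumr_ge0.
apply: le_lt_trans (h e1 K (val x) _ K0 _) (ltry _); first by rewrite e10 lexx.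
move=> i iL; apply: dist_admissible_le (hC i).
have iL' : (i < L.+1)%N by [].
rewrite /K (bigD1 (Ordinal iL')) //= addrCA lerDl.
by rewrite addr_ge0 // sumr_ge0.
Qed.

Lemma S_interp_norm_pnorm (alpha eps : R) : alpha_range nu alpha -> 0 < eps ->
  is_pnorm p (fine \o S_interp_norm nu alpha eps).
Proof.
move=> ar e0; have p01 := p_zero_bounds p_gt0; apply: gauge_pnorm => //.
- by move=> x; rewrite S_interp_norm_fin // andbT interp_norm_ge0.
- by move=> l x r; exact: interp_normZ.
- by move=> x y r t; exact: interp_normD.
- by move=> x x0; apply: val_inj; apply: interp_norm_eq0 x0.
Qed.

Variables A B : set R.
Hypothesis A_range : A `<=` alpha_range nu.
Hypothesis A_dense : alpha_range nu `<=` closure A.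
Hypothesis B_gt0 : forall eps, B eps -> 0 < eps.
Hypothesis B_small : forall eta : R, 0 < eta -> exists2 eps, B eps & eps < eta.

(** The closure only provides points near a given one, on either side. Hence a point [c] of the
    range strictly right of [a] is chosen first, and []a, a + d[] is used as its neighbourhood. *)
Lemma exists_alpha_right (a d : R) : alpha_range nu a -> 0 < d ->
  exists2 alpha, A alpha & a <= alpha < a + d.
Proof.
move=> [ma aM] d0.
have [c /andP[ac cd] cM] : exists2 c : R, a < c < a + d & (c%:E < alpha_max nu)%E.
  have [h|] := ltP (a + d / 2)%:E (alpha_max nu).
    exists (a + d / 2) => //; rewrite ltrDl divr_gt0 //= ltrD2l.
    by rewrite ltr_pdivrMr // ltr_pMr // ltr1n.
  case E : (alpha_max nu) aM => [M| |] //; rewrite lte_fin => aM; rewrite lee_fin => Md.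
  exists ((a + M) / 2); last by rewrite lte_fin midf_lt.
  rewrite midf_lt //=; apply: lt_trans (_ : M < _); rewrite ?midf_lt //.
  apply: le_lt_trans Md _; rewrite ltrD2l ltr_pdivrMr // ltr_pMr // ltr1n //.
have cr : alpha_range nu c.
  by split=> //; apply: le_trans ma _; rewrite lee_fin ltW.
have : nbhs c `]a, (a + d)[%classic.
  by apply: open_nbhs_nbhs; split; [exact: itv_open|rewrite /= in_itv /= ac].
move=> /(A_dense cr)[t [At]]; rewrite /= in_itv /= => /andP[h1 h2].
by exists t => //; rewrite (ltW h1) h2.
Qed.

(** A single member of the family suffices: a sup norm when [a] is below [alpha_min] or at least
    [alpha_max], and an interpolation norm in between. *)
Lemma family_dist_admissible (a e C : R) : 0 < e -> 0 < C ->
  exists q (eta : R), [/\ norm_family nu A B q, 0 < eta &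
    forall x : S_space nu, q x < eta ->
      dist_admissible a (nu a + e%:E)%E (val x) C].
Proof.
move=> e0 C0; have [p0 p1] := andP (p_zero_bounds p_gt0); rewrite -/p in p0 p1.
have besov eps eta : B eps ->
    (forall x, (besov_norm_inf (m - eps) x < eta%:E)%E ->
      dist_admissible a (nu a + e%:E)%E x C) ->
    forall x : S_space nu, (fine \o S_besov_norm_inf nu eps) x < eta ->
      dist_admissible a (nu a + e%:E)%E (val x) C.
  move=> /B_gt0 eps0 h x /= xq; apply: h; move: xq.
  rewrite -lte_fin fineK // ge0_fin_numE ?besov_norm_inf_ge0 //.
  exact: S_besov_norm_inf_fin.
have [am|ma] := ltP a m.
  have [eps Be he] : exists2 eps, B eps & eps < m - a by apply: B_small; rewrite subr_gt0.
  exists (fine \o S_besov_norm_inf nu eps), C; split=> //.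
    by left; exists eps.
  apply: besov => // x; rewrite (profile_below_min am).
  by apply: besov_dist_admissible_ninfty; [exact: ltW|lra].
have mina : (alpha_min nu <= a%:E)%E by rewrite -(fineK min_fin) lee_fin.
have [Ma|aM] := leP (alpha_max nu) a%:E.
  have [eps Be _] := B_small ltr01.
  have [eta eta0 h] := besov_dist_admissible_1 a (m - eps) e0 C0.
  exists (fine \o S_besov_norm_inf nu eps), eta; split=> //.
    by left; exists eps.
  by apply: besov => // x; rewrite profile_ge_max //; exact: h.
have ar : alpha_range nu a by [].
have [d d0 nud] : exists2 d : R, 0 < d & (nu (a + d)%R < (fine (nu a) + e / 2)%:E)%E.
  by apply: profile_right_lt; rewrite -[ltLHS]profile_fineK // lte_fin ltrDl divr_gt0.
(* Replacing [a] by [alpha] costs less than [e / 2] in the profile, and [p * eps] costs less than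
   [e / 2] because [p <= 1]. *)
have [alpha Aal /andP[aal ald]] := exists_alpha_right ar d0.
have [eps Be epse] := B_small (divr_gt0 e0 (ltr0Sn R 1)).
have [eta eta0 h] : exists2 eta : R, 0 < eta & forall x,
    (interp_norm nu p alpha eps x < eta%:E)%E ->
    dist_admissible a (fine (nu a) + e)%:E x C.
  apply: interp_dist_admissible => //.
  have alm : (alpha_min nu <= alpha%:E)%E by apply: le_trans mina _; rewrite lee_fin.
  have : fine (nu alpha) < fine (nu a) + e / 2.
    rewrite -lte_fin profile_fineK //; apply: le_lt_trans nud.
    exact/profile_nondecreasing/ltW.
  have : p * (alpha - a) >= 0 by rewrite mulr_ge0 ?subr_ge0 // ltW.
  have : p * eps <= 1 * eps by rewrite ler_wpM2r // ltW // B_gt0.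
  rewrite mulrBr (mulrBr p a); lra.
exists (fine \o S_interp_norm nu alpha eps), eta; split=> //.
  by right; exists (alpha, eps).
move=> x /= xq; rewrite -(profile_fineK mina) -EFinD; apply: h.
move: xq; rewrite -lte_fin fineK // ge0_fin_numE ?interp_norm_ge0 //.
by apply: S_interp_norm_fin; [exact: A_range|exact: B_gt0].
Qed.

Lemma family_pnorm q : norm_family nu A B q -> exists r, is_pnorm r q.
Proof.
case=> [[eps Be <-]|[[alpha eps] [/= /A_range ar Be] <-]].
  by exists 1; apply: S_besov_norm_inf_pnorm; exact: B_gt0.
by exists p; apply: S_interp_norm_pnorm => //; exact: B_gt0.
Qed.

Variables (a : nat -> R) (e : nat -> {posnum R}).
Hypothesis a_dense : dense (range a).
Hypothesis e_cvg0 : (fun i => (e i)%:num) @ \oo --> (0 : R).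

Lemma dense_seq_between (u v : R) : u < v -> exists2 t, range a t & u < t < v.
Proof.
move=> uv; have [|t [/= + at_]] := a_dense (O := `]u, v[%classic) _ (@itv_open _ _ u v).
  by exists ((u + v) / 2); rewrite /= in_itv /= !midf_lt.
by rewrite in_itv /= => ?; exists t.
Qed.

Lemma S_nbhs_family q (t : S_space nu) (r : R) : norm_family nu A B q -> 0 < r ->
  @nbhs _ (S_topology nu a e) t [set x | q (x - t) < r].
Proof.
move=> Fq r0; case: Fq => [[eps /B_gt0 eps0 <-]|[[alpha eps] [/= /A_range ar /B_gt0 eps0] <-]].
  (* A single level between [m - eps] and [m] controls this norm, the profile being -oo there. *)
  have [_ [n _ <-] /andP[h1 h2]] := @dense_seq_between (m - eps) m (ltac:(lra)).
  have r20 : 0 < r / 2 by rewrite divr_gt0.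
  apply: filterS (@S_topology_nbhs R nu a e t n 0%N (r / 2) r20) => x.
  move=> /d__lt; rewrite (profile_below_min h2) => /dist_admissible_ninfty h /=.
  have {}h : (S_besov_norm_inf nu eps (x - t)%R <= (r / 2)%:E)%E.
    exact: le_trans (besov_norm_inf_le _ (ltW h1)) h.
  rewrite -lte_fin fineK; last first.
    by rewrite ge0_fin_numE ?besov_norm_inf_ge0 //; exact: S_besov_norm_inf_fin.
  by apply: le_lt_trans h _; rewrite lte_fin ltr_pdivrMr // ltr_pMr // ltr1n.
have [L [b [e1 [e10 Db h]]]] :=
  interp_norm_le_admissible p_gt0 min_fin dense_seq_between ar eps0.
have /choice[n nb] : forall i, exists n, a n = b i.
  by move=> i; have [n _ <-] := Db i; exists n.
have [M eM] : exists M, (e M)%:num <= e1.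
  have [M _ /(_ M (leqnn M))] : \forall i \near \oo, (e i)%:num < e1 by exact: cvgr_lt e_cvg0 _ e10.
  by move=> /ltW; exists M.
have [p0 p1] := andP (p_zero_bounds p_gt0); rewrite -/p in p0 p1.
(* For [C <= 1] the bound (L C^(1+p))^(1/p) + C is at most [C * K], which the choice of [C] makes at
   most [r / 2]. *)
pose K := L%:R `^ p^-1 + 1 : R; have K0 : 0 < K by rewrite ltr_wpDl ?powR_ge0.
pose C := Num.min 1 (r / 2 / K).
have C0 : 0 < C by rewrite lt_min ltr01 !divr_gt0.
have C1 : C <= 1 by rewrite ge_min lexx.
have CK : C * K <= r / 2 by rewrite -ler_pdivlMr // ge_min lexx orbT.
have near_all : @nbhs _ (S_topology nu a e) t [set x | forall i : 'I_L.+1,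
   (d_ (a (n i)) (nu (a (n i)) + (e M)%:num%:E) (val (x - t)%R) < C%:E)%E].
  apply: (@filter_forall _ _ _ (@nbhs _ (S_topology nu a e) t)) => i.
  exact: (@S_topology_nbhs R nu a e t (n i) M C C0).
apply: filterS near_all => x /= hx.
have := h (e M)%:num C (val (x - t)).
rewrite eM (gt0 (e M)) C0 => /(_ isT isT) {}h.
have {}h : (S_interp_norm nu alpha eps (x - t)%R <= (C * K)%:E)%E.
  apply: le_trans (h _) _.
    move=> i iL; have := d__lt (hx (Ordinal (iL : (i < L.+1)%N))); by rewrite /= nb.
  rewrite lee_fin powRM ?powR_ge0 // /K mulrDr mulr1 lerD2r mulrC ler_wpM2r ?powR_ge0 //.
  rewrite -powRrM mulrDl mul1r mulfV ?gt_eqF // powRD ?(gt_eqF C0) ?implybT //.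
  rewrite powRr1 ?(ltW C0) // ler_piMl ?(ltW C0) //.
  have <- : 1 `^ p^-1 = 1 :> R by rewrite powR1.
  by apply: ge0_ler_powR; rewrite ?nnegrE ?invr_ge0 ?(ltW p0) ?(ltW C0).
rewrite -lte_fin fineK; last first.
  by rewrite ge0_fin_numE ?interp_norm_ge0 //; exact: S_interp_norm_fin.
apply: le_lt_trans h _; rewrite lte_fin; apply: le_lt_trans CK _.
by rewrite ltr_pdivrMr // ltr_pMr // ltr1n.
Qed.

(** Stated for general [A] and [B], this covers both the full family and its countable restrictions.
    Each inclusion compares neighbourhood filters at an arbitrary point. *)
Lemma S_open_norm_family : S_open nu a e = pnorm_open (norm_family nu A B).
Proof.
apply/seteqP; split=> U oU.
  suff : open (U : set (pnorm_topology (norm_family nu A B))) by [].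
  rewrite openE => t Ut; rewrite /interior.
  have Ut' : @nbhs _ (S_topology nu a e) t U by apply: open_nbhs_nbhs.
  have := @S_topology_cvg R nu a e (@nbhs _ (pnorm_topology (norm_family nu A B)) t) t _.
  apply => // n k r r0.
  (* Admissibility of a constant gives only a weak inequality for the distance; half the radius
     makes it strict. *)
  have r20 : 0 < r / 2 by rewrite divr_gt0.
  have [q [eta [Fq eta0 h]]] := family_dist_admissible (a n) (gt0 (e k)) r20.
  have q0 : q (t - t) < eta.
    have [s [s01 _ qZ _ _]] := family_pnorm Fq.
    by rewrite subrr -(scale0r (0 : S_space nu)) qZ Normc.normc0 mul0r.
  have : @nbhs _ (pnorm_topology (norm_family nu A B)) t [set x | q (x - t) < eta].
    by apply: open_nbhs_nbhs; split => //; exact: pnorm_ball_open.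
  apply: filterS => x /h /d__le /le_lt_trans; apply.
  by rewrite lte_fin ltr_pdivrMr // ltr_pMr // ltr1n.
suff : open (U : set (S_topology nu a e)) by [].
rewrite openE => t Ut; rewrite /interior.
have Ut' : @nbhs _ (pnorm_topology (norm_family nu A B)) t U by apply: open_nbhs_nbhs.
have := @pnorm_topology_cvg R _ (norm_family nu A B) (@nbhs _ (S_topology nu a e) t) t _.
apply => // q y r Fq r0 qr.
have [s [/andP[s0 s1] qge0 _ qD _]] := family_pnorm Fq.
(* The triangle inequality holds for s-th powers, so the room left around [t] in the ball is
   measured there. *)
pose rho := r `^ s - q (t - y) `^ s.
have rho0 : 0 < rho.
  by rewrite subr_gt0; apply: gt0_ltr_powR; rewrite ?nnegrE // ltW.
have := S_nbhs_family t Fq (powR_gt0 s^-1 rho0).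
apply: filterS => x /= xt; rewrite ltNge; apply/negP => rx.
have := qD (x - t) (t - y); rewrite addrA subrK => h.
have : q (x - t) `^ s < rho.
  rewrite -[ltRHS](@powRVK _ s) ?gt_eqF ?(ltW rho0) //.
  by apply: gt0_ltr_powR; rewrite ?nnegrE ?powR_ge0.
have : r `^ s <= q (x - y) `^ s.
  by apply: ge0_ler_powR; rewrite ?nnegrE ?qge0 // ltW.
move: h; rewrite /rho; lra.
Qed.

End NormFamilies.

(** * Countability and conclusion *)

Lemma countable_norm_family (R : realType) (nu : admissible_profile R) (A B : set R) :
  countable A -> countable B -> countable (norm_family nu A B).
Proof.
move=> cA cB; rewrite /norm_family -bigcup2E; apply: bigcup_countable => // -[|[|i]] _ /=.
- exact: sub_countable (card_image_le _ _) cB.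
- exact: sub_countable (card_image_le _ _) (countableX cA cB).
- exact: countable0.
Qed.

Theorem theorem2 (R : realType) (nu : admissible_profile R)
  (a : nat -> R) (e : nat -> {posnum R})
  (a_dense : dense (range a))
  (e_nonincreasing : nonincreasing_seq (fun m => (e m)%:num))
  (e_cvg0 : (fun m => (e m)%:num) @ \oo --> (0 : R))
  (alpha_min_real : alpha_min nu \is a fin_num)
  (p_zero_gt0 : (0 < p_zero nu)%E) :
  [/\ forall eps : R, 0 < eps ->
        (forall x : S_space nu, (S_besov_norm_inf nu eps x < +oo)%E) /\
        is_pnorm 1 (fine \o S_besov_norm_inf nu eps),
      forall alpha eps : R, alpha_range nu alpha -> 0 < eps ->
        (forall x : S_space nu, (S_interp_norm nu alpha eps x < +oo)%E) /\
        is_pnorm (fine (p_zero nu)) (fine \o S_interp_norm nu alpha eps),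
      S_open nu a e =
        pnorm_open (norm_family nu (alpha_range nu) [set eps | 0 < eps]) &
      forall alpha_ eps_ : nat -> R,
        alpha_range nu `<=` closure (range alpha_ `&` alpha_range nu) ->
        (forall m, 0 < eps_ m) -> eps_ @ \oo --> (0 : R) ->
        let F :=
          norm_family nu (range alpha_ `&` alpha_range nu) (range eps_) in
        countable F /\ S_open nu a e = pnorm_open F].
Proof.
split.
- by move=> eps eps0; split=> [x|]; [exact: S_besov_norm_inf_fin|exact: S_besov_norm_inf_pnorm].
- by move=> alpha eps ar eps0; split=> [x|]; [exact: S_interp_norm_fin|exact: S_interp_norm_pnorm].
- apply: S_open_norm_family => //; first exact: subset_closure.
  by move=> eta eta0; exists (eta / 2); rewrite /= ?divr_gt0 // ltr_pdivrMr // ltr_pMr // ltr1n.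
- move=> alpha_ eps_ Acl eps_gt0 eps_cvg F; split.
    apply: countable_norm_family; last exact: sub_countable (card_image_le _ _) _.
    exact: sub_countable (subset_card_le (@subIsetl _ _ _)) (sub_countable (card_image_le _ _) _).
  apply: S_open_norm_family => //.
  + by move=> _ [m _ <-].
  + move=> eta eta0.
    have [M _ /(_ M (leqnn M)) hM] : \forall i \near \oo, eps_ i < eta.
      exact: cvgr_lt eps_cvg _ eta0.
    by exists (eps_ M) => //; exists M.
Qed.
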